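(* Let $\alpha_1,\ldots,\alpha_m$ be ribbons and $D$ a skew diagram. For each $1\le i\le m$ let $\beta_i\in\{\alpha_i,\alpha_i^t,\alpha_i^\circ,(\alpha_i^t)^\circ\}$ (note $(\alpha_i^t)^\circ=(\alpha_i^\circ)^t$), and let $E\in\{D,D^t,D^\circ,(D^t)^\circ\}$. Then $$\mathfrak{s}_{\alpha_1\bullet\cdots\bullet\alpha_m\bullet D}=\mathfrak{s}_{\beta_1\bullet\cdots\bullet\beta_m\bullet E}.$$
   Context: Diagrams are drawn in English convention (rows numbered from the top, columns from the left) and skew diagrams $\lambda/\mu$ (for partitions $\mu\subseteq\lambda$) are considered up to translation. $D^t$ is the transpose (reflection in the main diagonal, $(\lambda/\mu)^t=\lambda^t/\mu^t$) and $D^\circ$ is the rotation of $D$ by 180 degrees. For skew diagrams $D_1,D_2$, the disjoint union $D_1\oplus D_2$ places $D_1$ strictly north and east of $D_2$ with no common row or column, the bottom row of $D_1$ in the row directly above the top row of $D_2$ and the leftmost column of $D_1$ directly right of the rightmost column of $D_2$. The concatenation $D_1\cdot D_2$ is obtained from $D_1\oplus D_2$ by moving all cells of $D_1$ one cell west, and the near concatenation $D_1\odot D_2$ by moving all cells of $D_1$ one cell south. These operations are associative and associate with each other, so strings $D_1\bigstar_1 D_2\bigstar_2\cdots\bigstar_{k-1}D_k$ with each $\bigstar_i\in\{\cdot,\odot\}$ need no parentheses. A ribbon is a connected skew diagram containing no $2\times2$ block of cells. The ribbon with $\alpha_i$ cells in its $i$-th row from the top is identified with the composition $\alpha=\alpha_1\cdots\alpha_\ell$.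 A ribbon with $k$ cells can be written uniquely as $\square\bigstar_1\square\bigstar_2\cdots\bigstar_{k-1}\square$, where $\square$ is a single cell and $\bigstar_i\in\{\cdot,\odot\}$. For such a ribbon $\alpha$ and a skew diagram $D$, the composition of transpositions is $\alpha\bullet D=D_1\bigstar_1D_2\bigstar_2\cdots\bigstar_{k-1}D_k$, where $D_i=D$ for $i$ odd and $D_i=D^t$ for $i$ even. The operation $\bullet$ is associative, so $\alpha_1\bullet\cdots\bullet\alpha_m\bullet D$ needs no parentheses. Skew Schur $Q$-functions are built from the alphabet $1'<1<2'<2<\cdots$. For strict partitions $\mu\subseteq\lambda$, the shifted skew diagram is obtained from $\lambda/\mu$ by shifting the $i$-th row $i-1$ cells to the right. A weakly amenable tableau of that shape is a filling in which rows and columns weakly increase, each row contains at most one $i'$ for each $i$, and each column contains at most one $i$ for each $i$. Then $Q_{\lambda/\mu}=\sum_T x_1^{c_1(T)}x_2^{c_2(T)}\cdots$, where $c_i(T)$ is the number of entries equal to $i$ or $i'$. Set $q_n=Q_{(n)}$, $q_0=1$, $q_n=0$ for $n<0$, and $\Omega=\mathbb{Z}[q_1,q_2,\ldots]$. For a skew diagram $D$, the ordinary skew Schur $Q$-function $\mathfrak{s}_D$ is $Q_{\lambda/\mu}$ for strict $\lambda,\mu$ whose shifted skew diagram is (a translate of) $D$. Equivalently, if $D=\nu/\kappa$ then $\mathfrak{s}_D=\det(q_{\nu_i-\kappa_j-i+j})_{i,j=1}^{\ell(\nu)}$, which is the image of the skew Schur function $s_D$ under the ring map $\theta$ sending the complete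 homogeneous symmetric function $h_n$ to $q_n$. For a ribbon $\alpha$, $\mathfrak{r}_\alpha:=\mathfrak{s}_\alpha$. *)

(* Defs.v *)
From mathcomp Require Import all_boot all_order all_algebra finmap zify.

Set Implicit Arguments.
Unset Strict Implicit.
Unset Printing Implicit Defensive.

Import Order.TTheory GRing.Theory Num.Theory.

Local Open Scope fset_scope.
Local Open Scope ring_scope.

(* Cells are (row, column), rows increasing downwards and columns rightwards. *)
Definition cell : Type := (int * int)%type.
Definition diagram : Type := {fset int * int}.

Definition translate (v : cell) (D : diagram) : diagram :=
  [fset (c.1 + v.1, c.2 + v.2) | c in D].

Definition same_shape (D E : diagram) : Prop := exists v, E = translate v D.

Definition is_part (la : seq nat) : bool := sorted geq la && (0%N \notin la).

Definition is_strict (la : seq nat) : bool :=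
  sorted (fun m n => n < m)%N la && (0%N \notin la).

Definition part_sub (mu la : seq nat) : Prop :=
  forall i, (nth 0 mu i <= nth 0 la i)%N.

Definition skew (la mu : seq nat) : diagram :=
  [fset c in [seq (i%:Z, j%:Z) | i <- iota 0 (size la),
                                 j <- index_iota (nth 0%N mu i) (nth 0%N la i)]].

Definition shifted_skew (la mu : seq nat) : diagram :=
  [fset c in [seq (i%:Z, (i + j)%N%:Z)
                | i <- iota 0 (size la),
                  j <- index_iota (nth 0%N mu i) (nth 0%N la i)]].

Definition is_skew_diagram (D : diagram) : Prop :=
  exists la mu, [/\ is_part la, is_part mu, part_sub mu la
                  & same_shape (skew la mu) D].

Definition transpose (D : diagram) : diagram := [fset (c.2, c.1) | c in D].

Definition rotate (D : diagram) : diagram := [fset (- c.1, - c.2) | c in D].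

(* E is one of D, D^t, D°, (D^t)°, as diagrams up to translation. *)
Definition is_variant (D E : diagram) : Prop :=
  [\/ same_shape D E, same_shape (transpose D) E, same_shape (rotate D) E
    | same_shape (rotate (transpose D)) E].

(* All four bounds are 0 on the empty diagram. *)
Definition top (D : diagram) : int :=
  \big[Order.min/(head (0, 0) D).1]_(c <- D) c.1.
Definition bottom (D : diagram) : int :=
  \big[Order.max/(head (0, 0) D).1]_(c <- D) c.1.
Definition left_ (D : diagram) : int :=
  \big[Order.min/(head (0, 0) D).2]_(c <- D) c.2.
Definition right_ (D : diagram) : int :=
  \big[Order.max/(head (0, 0) D).2]_(c <- D) c.2.

(* The position of D1 in the disjoint union of D1 and D2, with D2 kept fixed. *)
Definition place_ne (D1 D2 : diagram) : diagram :=
  translate (top D2 - 1 - bottom D1, right_ D2 + 1 - left_ D1) D1.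

Definition dsum (D1 D2 : diagram) : diagram := place_ne D1 D2 `|` D2.

Definition concat (D1 D2 : diagram) : diagram :=
  translate (0, -1) (place_ne D1 D2) `|` D2.

Definition near_concat (D1 D2 : diagram) : diagram :=
  translate (1, 0) (place_ne D1 D2) `|` D2.

Inductive star := Dot | Odot.

Definition star_op (s : star) : diagram -> diagram -> diagram :=
  match s with Dot => concat | Odot => near_concat end.

(* star_string [:: s_1; ...; s_(k-1)] D D' = D_1 s_1 D_2 s_2 ... s_(k-1) D_k,
   bracketed to the right, with D_i = D for i odd and D_i = D' for i even. *)
Fixpoint star_string (w : seq star) (D D' : diagram) : diagram :=
  if w is s :: w' then star_op s D (star_string w' D' D) else D.

Definition square : diagram := [fset (0, 0)].

Definition adjacent (c d : cell) : bool := `|c.1 - d.1| + `|c.2 - d.2| == 1.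

Definition connected (D : diagram) : Prop :=
  forall c d, c \in D -> d \in D ->
  exists p, [/\ path adjacent c p, last c p = d & {subset p <= D}].

Definition is_ribbon (D : diagram) : Prop :=
  [/\ is_skew_diagram D, D != fset0, connected D &
      forall i j, ~~ [&& (i, j) \in D, (i, j + 1) \in D,
                         (i + 1, j) \in D & (i + 1, j + 1) \in D]].

(* Along a ribbon, from its north-east end to its south-west end, the content
   column - row decreases by one at each step. *)
Definition ribbon_cells (D : diagram) : seq cell :=
  sort (fun c d : cell => d.2 - d.1 <= c.2 - c.1) D.

(* The word of a ribbon: a step down is a concatenation, a step left a near
   concatenation (see ribbon_wordP and ribbon_word_uniq). *)
Definition ribbon_word (D : diagram) : seq star :=
  if ribbon_cells D is c :: s then
    pairmap (fun c d : cell => if c.2 == d.2 then Dot else Odot) c s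
  else [::].

Definition bullet (A D : diagram) : diagram :=
  star_string (ribbon_word A) D (transpose D).

Definition bullets (As : seq diagram) (D : diagram) : diagram :=
  foldr bullet D As.

(* (i, true) is the marked letter (i+1)' and (i, false) the letter i+1. *)
Definition letter (n : nat) : Type := ('I_n * bool)%type.

Definition letter_le (n : nat) (x y : letter n) : bool :=
  (x.1 < y.1)%N || ((x.1 == y.1) && (y.2 ==> x.2)).

Definition same_row (D : diagram) (x y : D) : bool := (val x).1 == (val y).1.
Definition same_col (D : diagram) (x y : D) : bool := (val x).2 == (val y).2.

Definition weakly_amenable (D : diagram) (n : nat)
    (T : {ffun D -> 'I_n * bool}) : bool :=
  [&& [forall x : D, forall y : D,
         same_row x y && ((val x).2 <= (val y).2) ==> letter_le (T x) (T y)],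
      [forall x : D, forall y : D,
         same_col x y && ((val x).1 <= (val y).1) ==> letter_le (T x) (T y)],
      [forall x : D, forall y : D,
         [&& same_row x y, T x == T y & (T x).2] ==> (x == y)]
    & [forall x : D, forall y : D,
         [&& same_col x y, T x == T y & ~~ (T x).2] ==> (x == y)]].

Definition content (D : diagram) (n : nat) (T : {ffun D -> 'I_n * bool})
    (i : 'I_n) : nat :=
  #|[pred x : D | (T x).1 == i]|.

(* A formal power series in x_1, x_2, ... is given by its coefficients: its
   value at c is the coefficient of x_1^(c_1) ... x_n^(c_n), n = size c. *)
Definition series : Type := seq nat -> nat.

(* The generating series of the weakly amenable tableaux of shape D; those
   contributing to the coefficient at c only use letters up to size c. *)
Definition tableau_series (D : diagram) : series := fun c =>
  #|[pred T : {ffun D -> 'I_(size c) * bool} |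
      weakly_amenable T && [forall i, content T i == nth 0%N c i]]|.

Definition schurQ (la mu : seq nat) : series :=
  tableau_series (shifted_skew la mu).

(* Q_(la/mu) for any strict la, mu whose shifted skew diagram is a translate of
   D (see strict_skewP and ord_schurQE). *)
Definition ord_schurQ (D : diagram) : series := tableau_series D.

Lemma translateP (v : cell) (D : diagram) (c : cell) :
  (c \in translate v D) = ((c.1 - v.1, c.2 - v.2) \in D).
Proof.
apply/imfsetP/idP => [[d /= dD ->]|cD] /=.
  by rewrite !addrK; case: d dD.
by exists (c.1 - v.1, c.2 - v.2) => //=; rewrite !subrK; case: c {cD}.
Qed.

Lemma skewP (la mu : seq nat) (c : cell) :
  reflect (exists i j, [/\ c = (i%:Z, j%:Z), (i < size la)%N
                         & (nth 0%N mu i <= j < nth 0%N la i)%N])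
          (c \in skew la mu).
Proof.
rewrite /skew in_fset; apply: (iffP allpairsPdep).
  case=> i [j] []; rewrite mem_iota mem_index_iota /= add0n => Hi Hj ->.
  by exists i, j.
case=> i [j] [-> Hi Hj]; exists i, j.
by rewrite mem_iota mem_index_iota.
Qed.

Lemma shifted_skewP (la mu : seq nat) (c : cell) :
  reflect (exists i j, [/\ c = (i%:Z, (i + j)%N%:Z), (i < size la)%N
                         & (nth 0%N mu i <= j < nth 0%N la i)%N])
          (c \in shifted_skew la mu).
Proof.
rewrite /shifted_skew in_fset; apply: (iffP allpairsPdep).
  case=> i [j] []; rewrite mem_iota mem_index_iota /= add0n => Hi Hj ->.
  by exists i, j.
case=> i [j] [-> Hi Hj]; exists i, j.
by rewrite mem_iota mem_index_iota.
Qed.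

Lemma is_part_nth (la : seq nat) (i j : nat) :
  is_part la -> (i <= j)%N -> (nth 0%N la j <= nth 0%N la i)%N.
Proof.
case/andP=> srt _ le_ij; case: (ltnP j (size la)) => [jlt|jge]; last first.
  by rewrite nth_default.
have tr : transitive geq by move=> x y z /= h1 h2; apply: leq_trans h2 h1.
have rf : reflexive geq by move=> x /=.
exact: (sorted_leq_nth tr rf 0%N srt i j (leq_ltn_trans le_ij jlt) jlt le_ij).
Qed.

(* Every skew diagram is the shifted skew diagram of some strict partitions. *)
Lemma strict_skewP (D : diagram) : is_skew_diagram D ->
  exists la mu, [/\ is_strict la, is_strict mu, part_sub mu la
                  & same_shape (shifted_skew la mu) D].
Proof.
case=> nu [ka] [pnu pka sub [v ->]].
pose l := size nu.
pose up (s : seq nat) := mkseq (fun i => (nth 0%N s i + (l - i))%N) l.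
have sup s : size (up s) = l by rewrite size_mkseq.
have strict_up s : is_part s -> is_strict (up s).
  move=> ps; apply/andP; split; last first.
    apply/(nthP 0%N) => -[i]; rewrite sup => il.
    rewrite nth_mkseq // => /eqP.
    by rewrite addn_eq0 subn_eq0 leqNgt il andbF.
  apply/(sortedP 0%N) => i; rewrite sup => il.
  rewrite !nth_mkseq // ?(ltnW il) //.
  have := is_part_nth ps (leqnSn i).
  by move=> h; rewrite -addnS; apply: leq_add => //; rewrite ltn_sub2l // ltnW.
exists (up nu), (up ka); split; [exact: strict_up|exact: strict_up| |].
  move=> i; case: (ltnP i l) => il; last by rewrite !nth_default ?sup.
  by rewrite !nth_mkseq // leq_add2r.
exists (v.1, v.2 - l%:Z); apply/fsetP => c; rewrite !translateP /=.
apply/skewP/shifted_skewP => -[i [j]] [[e1 e2] il]; rewrite ?sup in il.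
  move=> /andP[h1 h2]; exists i, (j + (l - i))%N.
  rewrite sup !nth_mkseq // leq_add2r ltn_add2r h1 h2; split => //.
  congr (_, _) => //; rewrite addnCA subnKC ?(ltnW il) // PoszD -e2.
  by rewrite opprB addrA addrAC.
rewrite !nth_mkseq // => /andP[h1 h2]; exists i, (j - (l - i))%N.
have lj : (l - i <= j)%N by apply: leq_trans h1; apply: leq_addl.
split => //; last by rewrite leq_subRL // ltn_subLR // addnC h1 addnC.
congr (_, _) => //.
by move: e2 il lj; rewrite /l; lia.
Qed.

Lemma tableau_series_translate (v : cell) (D : diagram) :
  tableau_series (translate v D) =1 tableau_series D.
Proof.
move=> c; rewrite /tableau_series; set n := size c; set E := translate v D.
have fP (x : D) : ((val x).1 + v.1, (val x).2 + v.2) \in E.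
  by rewrite translateP /= !addrK; case: x => -[].
have gP (y : E) : ((val y).1 - v.1, (val y).2 - v.2) \in D.
  by case: y => y yE /=; rewrite translateP in yE.
pose f (x : D) : E := [` fP x]; pose g (y : E) : D := [` gP y].
have fK : cancel f g by case=> -[a b] p; apply/val_inj; rewrite /= !addrK.
have gK : cancel g f by case=> -[a b] p; apply/val_inj; rewrite /= !subrK.
pose F (T : {ffun E -> 'I_n * bool}) : {ffun D -> 'I_n * bool} :=
  [ffun x => T (f x)].
pose G (T : {ffun D -> 'I_n * bool}) : {ffun E -> 'I_n * bool} :=
  [ffun y => T (g y)].
have FK : cancel F G by move=> T; apply/ffunP => y; rewrite !ffunE gK.
have GK : cancel G F by move=> T; apply/ffunP => y; rewrite !ffunE fK.
have allf (P : pred E) : [forall y, P y] = [forall x, P (f x)].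
  apply/forallP/forallP => h x; first exact: h.
  by rewrite -[x]gK; apply: h.
rewrite -(card_image (can_inj FK)); apply: eq_card => T; rewrite !inE.
have -> : (T \in image F [pred T0 | weakly_amenable T0 &
             [forall i, content T0 i == nth 0%N c i]]) =
  (weakly_amenable (G T) && [forall i, content (G T) i == nth 0%N c i]).
  rewrite -{1}[T]GK mem_image; last exact: (can_inj FK).
  by rewrite inE.
congr (_ && _).
  rewrite /weakly_amenable !allf; congr [&& _, _, _ & _];
  apply: eq_forallb => x; rewrite !allf; apply: eq_forallb => y;
  by rewrite /same_row /same_col !ffunE !fK /= ?(can_eq fK)
     ?(inj_eq (@addIr _ _)) ?lerD2r.
apply: eq_forallb => i; congr (_ == _); rewrite /content.
rewrite -(card_image (can_inj fK)); apply: eq_card => y.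
by rewrite -[y]gK mem_image ?inE ?ffunE ?fK //; apply: can_inj fK.
Qed.

Lemma ord_schurQE (la mu : seq nat) (D : diagram) :
  same_shape (shifted_skew la mu) D -> schurQ la mu =1 ord_schurQ D.
Proof. by case=> v -> c; rewrite /ord_schurQ tableau_series_translate. Qed.

Definition cell_step (c d : cell) : bool :=
  (d == (c.1 + 1, c.2)) || (d == (c.1, c.2 - 1)).

Definition word_from (c : cell) (p : seq cell) : seq star :=
  pairmap (fun c d : cell => if c.2 == d.2 then Dot else Odot) c p.

Definition is_dot (s : star) : bool := if s is Dot then true else false.

Definition strip_head (w : seq star) : cell :=
  (- (count is_dot w)%:Z, (count (predC is_dot) w)%:Z).

Fixpoint strip (w : seq star) : seq cell :=
  strip_head w :: (if w is _ :: w' then strip w' else [::]).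

Lemma stripE w : strip w = strip_head w :: behead (strip w).
Proof. by case: w. Qed.

Lemma strip_bound w c : c \in strip w ->
  (strip_head w).1 <= c.1 /\ c.2 <= (strip_head w).2.
Proof.
elim: w => [|s w IH] /=; first by rewrite inE => /eqP ->.
rewrite inE => /orP[/eqP -> //|/IH [h1 h2]]; split.
  by apply: le_trans h1; rewrite /strip_head /= lerN2 lez_nat leq_addl.
by apply: le_trans h2 _; rewrite /strip_head /= lez_nat leq_addl.
Qed.

Lemma big_minE (D : diagram) (f : cell -> int) (x0 : cell) :
  x0 \in D -> (forall c, c \in D -> f x0 <= f c) ->
  \big[Order.min/f (head (0, 0) D)]_(c <- D) f c = f x0.
Proof.
move=> x0D h; apply/eqP; rewrite eq_le; apply/andP; split.
  by apply: (@ge_bigmin_seq _ _ _ _ _ x0).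
rewrite big_seq; elim/big_ind: _ => //.
- apply: h; suff : head (0, 0) D \in enum_fset D by [].
  have : x0 \in enum_fset D by [].
  by case: (enum_fset D) => //= c s _; rewrite mem_head.
- by move=> x y hx hy; rewrite le_min hx hy.
Qed.

Lemma big_maxE (D : diagram) (f : cell -> int) (x0 : cell) :
  x0 \in D -> (forall c, c \in D -> f c <= f x0) ->
  \big[Order.max/f (head (0, 0) D)]_(c <- D) f c = f x0.
Proof.
move=> x0D h; apply/eqP; rewrite eq_le; apply/andP; split; last first.
  by apply: (@le_bigmax_seq _ _ _ _ _ x0).
rewrite big_seq; elim/big_ind: _ => //.
- apply: h; suff : head (0, 0) D \in enum_fset D by [].
  have : x0 \in enum_fset D by [].
  by case: (enum_fset D) => //= c s _; rewrite mem_head.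
- by move=> x y hx hy; rewrite ge_max hx hy.
Qed.

Lemma star_string_square w : star_string w square square =i strip w.
Proof.
elim: w => [|s w IH] c; first by rewrite /= in_fset1 inE.
rewrite /=; set S := star_string w square square in IH *.
have hS : strip_head w \in S by rewrite IH stripE mem_head.
have tS : top S = (strip_head w).1.
  apply: (@big_minE _ (fun c : cell => c.1) _ hS) => d.
  by rewrite IH => /strip_bound [].
have rS : right_ S = (strip_head w).2.
  apply: (@big_maxE _ (fun c : cell => c.2) _ hS) => d.
  by rewrite IH => /strip_bound [].
have sq : (0, 0) \in square by rewrite in_fset1.
have bQ : bottom square = 0.
  by apply: (@big_maxE _ (fun c : cell => c.1) _ sq) => d; rewrite in_fset1 => /eqP->.
have lQ : left_ square = 0.
  by apply: (@big_minE _ (fun c : cell => c.2) _ sq) => d; rewrite in_fset1 => /eqP->.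
rewrite inE -IH; case: s => /=; rewrite /concat /near_concat in_fsetU !translateP /=;
  congr (_ || _); rewrite in_fset1 tS rS bQ lQ /strip_head /= -!pair_eqE /=; lia.
Qed.

Lemma strip_path (c : cell) (p : seq cell) : path cell_step c p ->
  c :: p = [seq (d.1 + (last c p).1, d.2 + (last c p).2)
             | d <- strip (word_from c p)].
Proof.
elim: p c => [|d p IH] c /=; first by rewrite !add0r; case: c.
case/andP=> st /IH {}IH; rewrite -IH; congr (_ :: _).
have := IH; rewrite stripE => -[] ed _.
have {ed} [e1 e2] : d.1 = (strip_head (word_from d p)).1 + (last d p).1 /\
           d.2 = (strip_head (word_from d p)).2 + (last d p).2 by rewrite {1 4}ed.
move: e1 e2; rewrite /strip_head /= -/(word_from d p) => e1 e2.
case/orP: st => /eqP ed; move: e1 e2; rewrite ed /= ?eqxx /=.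
  move=> e1 e2; rewrite [LHS]surjective_pairing; congr (_, _); lia.
have -> : (c.2 == c.2 - 1) = false by lia.
move=> /= e1 e2; rewrite [LHS]surjective_pairing; congr (_, _); lia.
Qed.

Definition cell_content (c : cell) : int := c.2 - c.1.

Lemma cell_step_content c d : cell_step c d -> cell_content d = cell_content c - 1.
Proof.
by rewrite /cell_content => /orP[] /eqP -> /=; rewrite ?opprD ?addrA // addrAC.
Qed.

Lemma ribbon_cells_path (D : diagram) (c : cell) (p : seq cell) :
  path cell_step c p -> D =i c :: p -> ribbon_cells D = c :: p.
Proof.
move=> cp eD.
pose gt (c d : cell) := cell_content d < cell_content c.
have tr : transitive gt by move=> x y z h1 h2; apply: lt_trans h2 h1.
have sgt : sorted gt (c :: p).
  apply: (@sub_path _ cell_step) cp => x y /cell_step_content.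
  by rewrite /gt => ->; rewrite gtrBl.
have ir : irreflexive gt by move=> x; rewrite /gt ltxx.
have uq : uniq (c :: p) by apply: sorted_uniq sgt.
have pq : perm_eq (ribbon_cells D) (c :: p).
  apply: uniq_perm => //; first by rewrite sort_uniq fset_uniq.
  by move=> x; rewrite mem_sort -eD.
pose ge (c d : cell) := cell_content d <= cell_content c.
have trg : transitive ge by move=> x y z h1 h2; apply: le_trans h2 h1.
have inj : {in c :: p &, injective cell_content}.
  move=> x y xs ys e; apply/eqP/negPn/negP => ne.
  have : (index x (c :: p) != index y (c :: p)).
    by apply: contra ne => /eqP /(congr1 (nth c (c :: p))); rewrite !nth_index // => ->.
  have H := sorted_ltn_nth tr c sgt.
  rewrite neq_ltn => /orP[] /H; rewrite !inE !index_mem.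
    by move=> /(_ xs ys); rewrite /gt !nth_index // e ltxx.
  by move=> /(_ ys xs); rewrite /gt !nth_index // e ltxx.
apply: (@sorted_eq_in _ ge) pq.
- by move=> x y z _ _ _; apply: trg.
- move=> x y; rewrite !mem_sort => xs ys h; apply: inj; rewrite -?eD //.
  by apply/eqP; rewrite eq_le andbC.
- by apply: sort_sorted => x y; apply: le_total.
- by apply: sub_path sgt => x y; apply: ltW.
Qed.

Lemma ribbon_word_path (D : diagram) (c : cell) (p : seq cell) :
  path cell_step c p -> D =i c :: p ->
  same_shape (star_string (ribbon_word D) square square) D.
Proof.
move=> cp eD; rewrite /ribbon_word (ribbon_cells_path cp eD) -/(word_from c p).
exists (last c p); apply/fsetP => x; rewrite eD translateP star_string_square.
rewrite (strip_path cp); set l := last c p; set w := word_from c p.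
have -> : x = (fun d : cell => (d.1 + l.1, d.2 + l.2)) (x.1 - l.1, x.2 - l.2).
  by rewrite /= !subrK; case: x.
rewrite mem_map /= ?addrK //.
by move=> [a b] [a' b'] [] /addIr -> /addIr ->.
Qed.

Lemma skew_convex (D : diagram) (i j i' j' a b : int) : is_skew_diagram D ->
  (i, j) \in D -> (i', j') \in D -> i <= a <= i' -> j <= b <= j' ->
  (a, b) \in D.
Proof.
case=> la [mu] [pla pmu sub [v ->]]; rewrite !translateP /=.
case/skewP=> x [y] [[ei ej] xl /andP[h1 h2]].
case/skewP=> x' [y'] [[ei' ej'] xl' /andP[h1' h2']].
rewrite -[i <= a](lerD2r (- v.1)) ei -[a <= i'](lerD2r (- v.1)) ei'.
rewrite -[j <= b](lerD2r (- v.2)) ej -[b <= j'](lerD2r (- v.2)) ej'.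
move=> /andP[ha1 ha2] /andP[hb1 hb2].
case ea: (a - v.1) ha1 ha2 => [m|m] //; rewrite !lez_nat => ha1 ha2.
case eb: (b - v.2) hb1 hb2 => [n|n] //; rewrite !lez_nat => hb1 hb2.
apply/skewP; exists m, n; split => //; first exact: leq_ltn_trans xl'.
rewrite (leq_trans _ (leq_trans h1 hb1)) ?is_part_nth //=.
by apply: leq_ltn_trans hb2 (leq_trans h2' _); apply: is_part_nth.
Qed.

Lemma ribbon_content_inj (D : diagram) : is_ribbon D ->
  {in D &, injective cell_content}.
Proof.
case=> sk _ _ no22.
have aux i j i' j' : (i, j) \in D -> (i', j') \in D ->
    j - i = j' - i' -> i < i' -> False.
  move=> cD dD e lt; have lt' : j < j' by lia.
  have q a b : i <= a <= i' -> j <= b <= j' -> (a, b) \in D.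
    exact: skew_convex sk cD dD.
  by have := no22 i j; rewrite cD !q //; lia.
move=> [i j] [i' j'] cD dD; rewrite /cell_content /= => e.
case: (ltgtP i i') => [lt|lt|ei].
- by case: (aux _ _ _ _ cD dD e lt).
- by case: (aux _ _ _ _ dD cD (esym e) lt).
- by rewrite ei in e *; move/addIr: e => ->.
Qed.

Lemma adjacent_content (c d : cell) : adjacent c d ->
  cell_content d < cell_content c -> cell_step c d.
Proof.
case: c d => [i j] [i' j']; rewrite /adjacent /cell_content /cell_step /=.
rewrite -!pair_eqE /=; lia.
Qed.

Lemma ribbon_next (D : diagram) (c d : cell) : is_ribbon D ->
  c \in D -> d \in D -> cell_content d < cell_content c ->
  exists2 e, e \in D & cell_step c e.
Proof.
move=> rD cD dD lt; have inj := ribbon_content_inj rD.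
case: rD => _ _ /(_ _ _ cD dD) [p [pp lp sp]] _.
have : cell_content c <= cell_content c by [].
have := cD; move: pp lp; move: {1 2 3 5}c => x.
elim: p x sp => [|y p IH] x sp /=; first by move=> _ -> _; rewrite leNgt lt.
case/andP=> axy pp lp xD cx.
have yD : y \in D by apply: sp; rewrite mem_head.
have sp' : {subset p <= D} by move=> z zp; apply: sp; rewrite inE zp orbT.
case: (leP (cell_content c) (cell_content y)) => cy; first exact: IH pp lp yD cy.
exists y => //.
have st := adjacent_content axy (lt_le_trans cy cx).
suff -> : c = x by [].
apply: inj => //; have := cell_step_content st; lia.
Qed.

(* A ribbon is, up to translation, the string of squares given by its word. *)
Lemma ribbon_wordP (D : diagram) : is_ribbon D ->
  same_shape (star_string (ribbon_word D) square square) D.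
Proof.
move=> rD; have inj := ribbon_content_inj rD.
have eD : D =i ribbon_cells D by move=> x; rewrite mem_sort.
have uq : uniq (ribbon_cells D) by rewrite sort_uniq fset_uniq.
pose ge (c d : cell) := cell_content d <= cell_content c.
have srt : sorted ge (ribbon_cells D).
  by apply: sort_sorted => x y; apply: le_total.
have trg : transitive ge by move=> x y z h1 h2; apply: le_trans h2 h1.
have rfg : reflexive ge by move=> x; apply: lexx.
have st : sorted cell_step (ribbon_cells D).
  apply/(sortedP (0, 0)) => i il; set s := ribbon_cells D in eD uq srt il *.
  have il' := ltnW il.
  have le := sorted_leq_nth trg rfg (0, 0) srt.
  have iD : nth (0, 0) s i \in D by rewrite eD mem_nth.
  have jD : nth (0, 0) s i.+1 \in D by rewrite eD mem_nth.
  have lt : cell_content (nth (0, 0) s i.+1) < cell_content (nth (0, 0) s i).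
    rewrite lt_neqAle; apply/andP; split; last by apply: le; rewrite ?inE.
    apply/eqP => /(inj _ _ jD iD) /eqP.
    by rewrite nth_uniq // eqn_leq ltnn.
  have [e eDD se] := ribbon_next rD iD jD lt.
  suff -> : nth (0, 0) s i.+1 = e by [].
  apply: inj => //; have ce := cell_step_content se.
  move: eDD; rewrite eD => /(nthP (0, 0)) [k ks ek].
  case: (leqP k i) => ki.
    by have := le k i ks il' ki; rewrite /ge ek ce lerBrDr gerDl.
  have h1 := le i.+1 k il ks ki; rewrite /ge ek ce in h1.
  by apply/eqP; rewrite eq_le ce h1 andbT lerBrDr lezD1.
case e: (ribbon_cells D) st => [|c p] st; last first.
  by apply: (ribbon_word_path (c := c) (p := p)) => //; rewrite -e.
case: rD => _ /fset0Pn [x]; rewrite eD e => //.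
Qed.

Lemma strip_sorted w : sorted cell_step (strip w).
Proof.
elim: w => //= s w; rewrite [strip w]stripE /= => ->; rewrite andbT.
rewrite /cell_step /strip_head /= -!pair_eqE /=; case: s => /=; lia.
Qed.

Lemma ribbon_word_string (w : seq star) (v : cell) :
  ribbon_word (translate v (star_string w square square)) = w.
Proof.
pose f (d : cell) : cell := (d.1 + v.1, d.2 + v.2).
have step_f c d : cell_step (f c) (f d) = cell_step c d.
  by rewrite /cell_step /f /= -!pair_eqE /=; lia.
have /ribbon_cells_path e : path cell_step (f (strip_head w)) (map f (behead (strip w))).
  rewrite path_map (eq_path (e' := cell_step)); last by move=> x y; apply: step_f.
  by have := strip_sorted w; rewrite stripE.
rewrite /ribbon_word e; last first.
  move=> x; rewrite translateP star_string_square -map_cons -stripE.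
  have -> : x = f (x.1 - v.1, x.2 - v.2) by rewrite /f /= !subrK; case: x.
  rewrite mem_map /= ?addrK //.
  by move=> [a b] [a' b'] [] /addIr -> /addIr ->.
elim: w {e} => //= s w IH; rewrite [strip w]stripE /= IH; congr (_ :: _).
rewrite /strip_head /= (inj_eq (@addIr _ _)); case: s => /=; first by rewrite eqxx.
by case: eqP => //; lia.
Qed.

Lemma ribbon_word_uniq (D : diagram) (w : seq star) :
  same_shape (star_string w square square) D -> ribbon_word D = w.
Proof. by case=> v ->; apply: ribbon_word_string. Qed.

(* Main.v *)
From mathcomp Require Import all_boot all_order all_algebra finmap zify ring.
From mathcomp Require Import mpoly.
Require Import Defs.

(** Every letter of a tableau fills a vertical strip (marked) or a horizontal
strip (unmarked), so that the generating function of a skew diagram is an entry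
of a product of transfer matrices indexed by the order ideals of the diagram.  A
horizontal matrix commutes with a vertical one, because a row of any skew shape
has one leftmost and one rightmost cell; moreover the vertical matrix at [-x] is
the inverse of the horizontal matrix at [x], hence all transfer matrices commute.
Thus the letters may be permuted, and transposition and rotation, which merely
swap or reverse them, leave the generating function unchanged.

Comparing the two letters that meet at the junction gives
[s_D1 s_D2 = s_(D1 . D2) + s_(D1 (.) D2)].  By this rule the function of a string
of alternate copies of [D] and [D^t] is determined by those of the strings with
all stars equal to [(.)], and the alternating relation between these and the
strings with all stars equal to [.] shows, by induction on the length and up to a
factor 2, that exchanging [D] and [D^t] changes nothing.  Hence replacing [D] by
a variant is harmless in every string.  As a string of strings is again a string,
and the variants of a string are the strings of the variants, the composition
factors can be replaced one at a time. *)

Set Implicit Arguments.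
Unset Strict Implicit.
Unset Printing Implicit Defensive.

Import Order.TTheory GRing.Theory Num.Theory.

Local Open Scope fset_scope.
Local Open Scope ring_scope.

(** * Strips and transfer matrices *)

(** Commuting steps allow any letter of the word to be moved to the front; [f] will be
    multiplication of a row vector by the transfer matrix of a letter. *)
Lemma foldl_perm (A : Type) (B : eqType) (f : A -> B -> A) :
  (forall v a b, f (f v a) b = f (f v b) a) ->
  forall (s t : seq B) (v : A), perm_eq s t -> foldl f v s = foldl f v t.
Proof.
move=> fC; have move_front a s v : foldl f v (rcons s a) = foldl f (f v a) s.
  by elim: s v => //= b s IH v; rewrite IH fC.
elim=> [|a s IH] t v; first by rewrite perm_sym => /perm_nilP ->.
move=> pst; have /splitPr st : a \in t by rewrite -(perm_mem pst) mem_head.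
case: st pst => t1 t2 pst.
have {}pst : perm_eq s (t1 ++ t2).
  by rewrite -(perm_cons a) (perm_trans pst) // perm_catC /= perm_cons perm_catC.
by rewrite -cat_rcons foldl_cat move_front /= (IH _ _ pst) foldl_cat.
Qed.

Section Lines.
Variable T : finType.
Implicit Types (r c : T -> int) (g : {set T}).

(** When [g] is filled by a strip that is thin in [c] followed by one that is thin in [r], the cells
    of [has_after r c g] are forced into the first strip and those of [has_before c r g] into the
    second. *)
Definition has_after r c g : {set T} :=
  [set z in g | [exists w in g, (r z == r w) && (c z < c w)]].
Definition has_before r c g : {set T} :=
  [set z in g | [exists w in g, (r z == r w) && (c w < c z)]].

Lemma has_afterP r c g z :
  reflect (z \in g /\ exists w, [/\ w \in g, r z = r w & c z < c w])
          (z \in has_after r c g).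
Proof.
rewrite inE; apply: (iffP andP) => -[zg].
  by case/exists_inP=> w wg /andP[/eqP rzw czw]; split=> //; exists w.
by case=> w [wg rzw czw]; split=> //; apply/exists_inP; exists w; rewrite ?rzw ?eqxx.
Qed.

Lemma has_beforeP r c g z :
  reflect (z \in g /\ exists w, [/\ w \in g, r z = r w & c w < c z])
          (z \in has_before r c g).
Proof.
rewrite inE; apply: (iffP andP) => -[zg].
  by case/exists_inP=> w wg /andP[/eqP rzw czw]; split=> //; exists w.
by case=> w [wg rzw czw]; split=> //; apply/exists_inP; exists w; rewrite ?rzw ?eqxx.
Qed.

(* The successor map along a line is injective. *)
Lemma leq_card_has_after r c g :
  (forall x y, r x = r y -> c x = c y -> x = y) ->
  (#|has_after r c g| <= #|has_before r c g|)%N.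
Proof.
move=> inj; pose P z w := [&& w \in g, r z == r w & c z < c w].
pose next z := if [pick w | P z w] is Some w0
               then [arg min_(w < w0 | P z w) c w]%O else z.
have nextP z : z \in has_after r c g ->
    P z (next z) /\ forall w, P z w -> c (next z) <= c w.
  case/has_afterP=> zg [w [wg rzw czw]]; rewrite /next.
  case: pickP => [w0 Pw0|/(_ w)]; last by rewrite /P wg rzw eqxx czw.
  by case: arg_minP => // w1 Pw1 h; split.
have next_inj : {in has_after r c g &, injective next}.
  have aux x y : x \in has_after r c g -> y \in has_after r c g ->
      next x = next y -> ~ (c x < c y).
    move=> xA yA e lt; have [/and3P[_ /eqP rx _] minx] := nextP _ xA.
    have [/and3P[_ /eqP ry cy] _] := nextP _ yA.
    have yg : y \in g by case/has_afterP: yA.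
    have /minx : P x y by rewrite /P yg rx e -ry eqxx lt.
    by rewrite e leNgt cy.
  move=> x y xA yA e; have nxy := aux _ _ xA yA e; have nyx := aux _ _ yA xA (esym e).
  apply: inj; last by apply/eqP; rewrite eq_le !leNgt; apply/andP; split; apply/negP.
  have [/and3P[_ /eqP -> _] _] := nextP _ xA; rewrite e.
  by have [/and3P[_ /eqP -> _] _] := nextP _ yA.
rewrite -(card_in_imset next_inj); apply/subset_leq_card/subsetP => w.
case/imsetP=> z zA ->; have [/and3P[ng /eqP rz cz] _] := nextP _ zA.
by apply/has_beforeP; split=> //; exists z; split=> //; case/has_afterP: zA.
Qed.

(** Each line meeting [g] has one last and one first cell, so both sets miss one cell per line. The
    reverse inequality comes from reversing the lines. *)
Lemma card_has_after r c g :
  (forall x y, r x = r y -> c x = c y -> x = y) ->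
  #|has_after r c g| = #|has_before r c g|.
Proof.
move=> inj; apply/eqP; rewrite eqn_leq leq_card_has_after //=.
pose c' z := - c z.
have inj' x y : r x = r y -> c' x = c' y -> x = y.
  by move=> rxy /oppr_inj; apply: inj.
have := leq_card_has_after g inj'.
suff [-> ->] : has_after r c' g = has_before r c g /\
               has_before r c' g = has_after r c g by [].
by split; apply/setP => z; rewrite !inE; congr (_ && _);
  apply: eq_existsb => w; rewrite ltrN2.
Qed.

End Lines.

Section SetSums.
Variables (R : comNzRingType) (T : finType) (x y : R).

(** Expanding the product decides for each cell of [g] whether it goes into [A], which is barred on
    [U], or stays outside, which is barred on [B]. *)
Lemma sum_between_sets (B U g : {set T}) : B \subset g ->
  \sum_(A : {set T} | (B \subset A) && (A \subset g :\: U))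
     x ^+ #|A| * y ^+ #|g :\: A| =
  \prod_(z in g) ((z \notin U)%:R * x + (z \notin B)%:R * y).
Proof.
move=> Bg.
(* Cells outside [g] get the factor [0 + 1], which keeps them out of [A] and lets the product range
   over all of [T]. *)
pose F z : R := if z \in g then (z \notin U)%:R * x else 0.
pose H z : R := if z \in g then (z \notin B)%:R * y else 1.
transitivity (\prod_z (F z + H z)); last first.
  rewrite [RHS]big_mkcond /=; apply: eq_bigr => z _; rewrite /F /H.
  by case: ifP => // _; rewrite add0r.
rewrite bigA_distr big_mkcond /=; apply: eq_bigr => A _.
case: ifP => [/andP[BA /subsetP AgU]|].
  rewrite (bigID (mem A)) /=; congr (_ * _).
    rewrite -prodr_const; apply: eq_bigr => z zA; rewrite zA /F.
    by have := AgU _ zA; rewrite inE => /andP[-> ->]; rewrite mul1r.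
  rewrite (bigID (mem g)) /= [X in _ = _ * X]big1 ?mulr1; last first.
    by move=> z /andP[/negbTE zA /negbTE zg]; rewrite zA /H zg.
  rewrite -prodr_const; apply: eq_big => z; first by rewrite inE andbC.
  rewrite inE => /andP[zA zg]; rewrite (negbTE zA) /H zg.
  by rewrite (contraNN (subsetP BA z) zA) mul1r.
move/negbT; rewrite negb_and => /orP[] /subsetPn[z].
  move=> zB zA; rewrite (bigD1 z) //= (negbTE zA) /H (subsetP Bg) // zB /=.
  by rewrite !mul0r.
move=> zA; rewrite inE negb_and negbK => h; rewrite (bigD1 z) //= zA /F.
by case/orP: h => [->|/negbTE ->]; rewrite /= ?if_same ?mul0r //; case: ifP; rewrite !mul0r.
Qed.

(** Cells of [B] contribute [x], cells of [U] contribute [y], cells of both 0, all others [x + y].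
    So only the cardinals and the disjointness of [B] and [U] matter. *)
Lemma prod_two_sets (B U g : {set T}) : B \subset g -> U \subset g ->
  \prod_(z in g) ((z \notin U)%:R * x + (z \notin B)%:R * y) =
  if B :&: U == set0 then x ^+ #|B| * y ^+ #|U| * (x + y) ^+ (#|g| - (#|B| + #|U|))
  else 0.
Proof.
move=> Bg Ug; case: eqP => [BU0|/eqP/set0Pn[z]]; last first.
  rewrite inE => /andP[zB zU]; rewrite (bigD1 z) /= ?(subsetP Bg) // zB zU.
  by rewrite !mul0r addr0 mul0r.
have dBU z : z \in B -> z \notin U.
  by move=> zB; apply/negP => zU; have := in_set0 z; rewrite -BU0 inE zB zU.
rewrite (bigID (mem B)) /= -mulrA; congr (_ * _).
  rewrite -prodr_const; apply: eq_big => [z|z /andP[_ zB]].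
    by apply/andP/idP => [[]|zB] //; split=> //; apply: (subsetP Bg).
  by rewrite (dBU _ zB) zB /= mul1r mul0r addr0.
rewrite (bigID (mem U)) /=; congr (_ * _).
  rewrite -prodr_const; apply: eq_big => [z|z /andP[/andP[_ zB] zU]].
    apply/andP/idP => [[]|zU] //; split=> //; rewrite (subsetP Ug) //=.
    by apply: contraL zU => /dBU.
  by rewrite (negbTE zB) zU /= mul1r mul0r add0r.
have -> : (#|g| - (#|B| + #|U|))%N = #|(g :\: B) :\: U|.
  rewrite setDDl cardsD (setIidPr _); last by rewrite subUset Bg Ug.
  by rewrite cardsU BU0 cards0 subn0.
rewrite -prodr_const; apply: eq_big => [z|z /andP[/andP[_ zB] zU]].
  by rewrite !inE -andbA; case: (z \in g); case: (z \in B); case: (z \in U).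
by rewrite zB zU !mul1r.
Qed.

End SetSums.

(** The order-theoretic content of a skew shape: the rectangle spanned by two comparable cells has
    its north-east and south-west corners in the shape. The axioms are symmetric in rows and
    columns, see [planar_tr]. *)
Record planar (T : finType) (le : rel T) (r c : T -> int) : Prop := Planar {
  planar_le : forall x y, le x y = (r x <= r y) && (c x <= c y);
  planar_inj : forall x y, r x = r y -> c x = c y -> x = y;
  planar_ne : forall x y, le x y -> exists z, r z = r x /\ c z = c y;
  planar_sw : forall x y, le x y -> exists z, r z = r y /\ c z = c x }.

Lemma planar_tr (T : finType) (le : rel T) (r c : T -> int) :
  planar le r c -> planar le c r.
Proof.
case=> leE inj ne sw; split=> [x y|x y cxy rxy|x y /sw[z []]|x y /ne[z []]].
- by rewrite leE andbC.
- exact: inj.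
- by exists z.
- by exists z.
Qed.

Section Ideals.
Variables (T : finType) (le : rel T).

Definition is_ideal (J : {set T}) : bool :=
  [forall x, forall y, le x y && (y \in J) ==> (x \in J)].

Lemma is_idealP (J : {set T}) :
  reflect (forall x y, le x y -> y \in J -> x \in J) (is_ideal J).
Proof.
apply: (iffP forallP) => [h x y xy yJ|h x].
  by have /forallP/(_ y)/implyP := h x; apply; rewrite xy.
by apply/forallP => y; apply/implyP => /andP[]; apply: h.
Qed.

(** For a difference of ideals this is a horizontal strip if [c] is the column and a vertical strip
    if it is the row. *)
Definition thin (c : T -> int) (A : {set T}) : bool :=
  [forall x in A, forall y in A, (c x == c y) ==> (x == y)].

Lemma thinP (c : T -> int) (A : {set T}) :
  reflect {in A &, injective c} (thin c A).
Proof.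
apply: (iffP forall_inP) => [h x y xA yA /eqP cxy|h x xA].
  by have /forall_inP/(_ y yA)/implyP/(_ cxy)/eqP := h x xA.
by apply/forall_inP => y yA; apply/implyP => /eqP cxy; apply/eqP/h.
Qed.

Local Notation ideal := {J : {set T} | is_ideal J}.

Lemma ideal_convex (I J : ideal) (u w q : T) :
  u \in val J :\: val I -> w \in val J :\: val I -> le u q -> le q w ->
  q \in val J :\: val I.
Proof.
rewrite !inE => /andP[uI _] /andP[_ wJ] uq qw.
rewrite ((is_idealP _ (valP J)) _ _ qw wJ) andbT.
by apply: contraNN uI => /((is_idealP _ (valP I)) _ _ uq).
Qed.

Section Strips.
Variables r c : T -> int.
Hypothesis pl : planar le r c.

Let leE := planar_le pl.
Let inj := planar_inj pl.

(** If [w] is to the right of [z] and [u] above it, the cell [q] in the row of [u] and the column of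
    [w] has [u] to its left and [w] below it. Hence the two orders of a horizontal and a vertical
    strip are obstructed simultaneously. *)
Lemma has_corner (I J : ideal) (z : T) :
  let g := val J :\: val I in
  z \in has_after r c g -> z \in has_before c r g ->
  exists q, q \in has_before r c g :&: has_after c r g.
Proof.
move=> g /has_afterP[zg [w [wg rzw czw]]] /has_beforeP[_ [u [ug czu ruz]]].
have luw : le u w by rewrite leE -rzw -czu !ltW.
have [q [rq cq]] := planar_ne pl luw.
have qg : q \in g by apply: (ideal_convex ug wg); rewrite leE rq cq; lia.
exists q; rewrite in_setI; apply/andP; split.
  by apply/has_beforeP; split=> //; exists u; rewrite cq -czu.
by apply/has_afterP; split=> //; exists w; rewrite rq -rzw.
Qed.

(** As [K] is an ideal, a cell outside [K] has all later cells of its row outside too, so thinness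
    of the upper piece forces cells with a later one in their row into [K]. Dually, a cell with one
    above it in its column cannot be in [K]. *)
Lemma thin_between (I K J : ideal) :
  val I \subset val K -> val K \subset val J ->
  let g := val J :\: val I in
  thin c (val K :\: val I) && thin r (val J :\: val K) =
  (has_after r c g \subset val K :\: val I) &&
  (val K :\: val I \subset g :\: has_before c r g).
Proof.
move=> IK KJ g; have idK := is_idealP _ (valP K).
apply/andP/andP => [[/thinP tc /thinP tr]|[/subsetP aft /subsetP bef]].
  split; apply/subsetP => z.
    case/has_afterP; rewrite inE => /andP[zI zJ] [w [wg rzw czw]].
    rewrite inE zI /=; apply: contraT => zK.
    have wK : w \notin val K.
      by apply: contraNN zK => /(idK z w); apply; rewrite leE rzw lexx ltW.
    move: wg; rewrite inE => /andP[_ wJ].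
    by have := tr z w; rewrite !inE zK wK zJ wJ => /(_ isT isT rzw) ezw;
       move: czw; rewrite ezw ltxx.
  rewrite inE => /andP[zI zK]; rewrite !in_setD zI (subsetP KJ _ zK) /= andbT.
  apply/negP => /has_beforeP[zg [w [wg czw rwz]]].
  have wK : w \in val K by apply: (idK w z) => //; rewrite leE czw lexx ltW.
  move: wg; rewrite inE => /andP[wI _].
  have := tc z w; rewrite !inE zI wI zK wK => /(_ isT isT czw) ezw.
  by move: rwz; rewrite ezw ltxx.
have inJ z : z \in val K -> z \in val J by apply: (subsetP KJ).
have notI z : z \notin val K -> z \notin val I by apply: contraNN; apply: (subsetP IK).
split; apply/thinP => x y.
  have aux u w : u \in val K :\: val I -> w \in val K :\: val I -> c u = c w ->
      ~ (r u < r w).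
    move=> uK wK cuw ruw; have := bef _ wK; rewrite in_setD => /andP[/negP nb _]; apply: nb.
    move: uK wK; rewrite !in_setD => /andP[uI uK] /andP[wI wK].
    by apply/has_beforeP; rewrite !inE wI inJ //; split=> //; exists u; rewrite !inE uI inJ.
  move=> xK yK cxy; apply: inj => //; have h1 := aux _ _ xK yK cxy.
  by have h2 := aux _ _ yK xK (esym cxy); lia.
have aux u w : u \in val J :\: val K -> w \in val J :\: val K -> r u = r w ->
    ~ (c u < c w).
  rewrite !in_setD => /andP[uK uJ] /andP[wK wJ] ruw cuw.
  have : u \in has_after r c g.
    by apply/has_afterP; rewrite !inE uJ notI //; split=> //; exists w; rewrite !inE notI // wJ.
  by move/aft; rewrite inE (negbTE uK) andbF.
move=> xK yK rxy; apply: inj => //; have h1 := aux _ _ xK yK rxy.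
by have h2 := aux _ _ yK xK (esym rxy); lia.
Qed.

(** Let [z] in [g] lie below some [x] of [A] in the order. In the same row [z] has a later cell, so
    it is in [A]; otherwise the corner of [z] and [x] lies above [x] in its column, which [A]
    excludes. *)
Lemma ideal_between (I J : ideal) (A : {set T}) :
  let g := val J :\: val I in
  has_after r c g \subset A -> A \subset g :\: has_before c r g ->
  is_ideal (val I :|: A).
Proof.
move=> g /subsetP aft /subsetP bef; apply/is_idealP => z x zx; rewrite !inE.
case/orP=> [xI|xA]; first by rewrite ((is_idealP _ (valP I)) _ _ zx xI).
case zI: (z \in val I) => //=.
have := bef _ xA; rewrite in_setD => /andP[/negP nbef xg].
have zg : z \in g.
  rewrite inE zI /=; apply: (is_idealP _ (valP J)) zx _.
  by move: xg; rewrite inE => /andP[].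
move: (zx); rewrite leE => /andP[]; rewrite le_eqVlt => /orP[/eqP rzx|rzx].
  rewrite le_eqVlt => /orP[/eqP czx|czx]; first by rewrite (inj rzx czx).
  by move=> *; apply: aft; apply/has_afterP; split=> //; exists x.
move=> czx; case: nbef; have [q [rq cq]] := planar_ne pl zx.
apply/has_beforeP; split=> //; exists q; split=> //; last by rewrite rq.
by apply: (ideal_convex zg xg); rewrite leE rq cq; lia.
Qed.

(** A cell maximising [c - r] works, because moving right in a row or up in a column increases this
    number. Such a cell may join either strip. *)
Lemma has_end (I J : ideal) : let g := val J :\: val I in
  g != set0 -> exists z, [/\ z \in g, z \notin has_after r c g
                           & z \notin has_before c r g].
Proof.
move=> g /set0Pn[z0 z0g].
case: (@arg_maxP _ _ _ z0 (mem g) (fun z => c z - r z) z0g) => z zg zmax.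
exists z; split=> //; apply/negP.
  by case/has_afterP=> _ [w [/zmax h rzw czw]]; lia.
by case/has_beforeP=> _ [w [/zmax h czw rwz]]; lia.
Qed.

End Strips.

Section Transfer.
Variable R : comNzRingType.

(** The weight of enlarging [I] to [J] by cells carrying one and the same letter, of value [x]. *)
Definition kernel (c : T -> int) (x : R) (I J : ideal) : R :=
  if (val I \subset val J) && thin c (val J :\: val I)
  then x ^+ #|val J :\: val I| else 0.

(** By [thin_between] and [ideal_between] the intermediate ideals [K] correspond to the sets between
    two bounds, over which [sum_between_sets] sums. *)
Lemma kernel_convE (r c : T -> int) (x y : R) (I J : ideal) : planar le r c ->
  let g := val J :\: val I in
  \sum_K kernel c x I K * kernel r y K J =
  if val I \subset val J then
    \prod_(z in g) ((z \notin has_before c r g)%:R * x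
                  + (z \notin has_after r c g)%:R * y)
  else 0.
Proof.
move=> pl g; case: ifP => IJ; last first.
  apply: big1 => K _; rewrite /kernel.
  case: ifP => [/andP[IK _]|]; last by rewrite mul0r.
  case: ifP => [/andP[KJ _]|]; last by rewrite mulr0.
  by rewrite (subset_trans IK KJ) in IJ.
rewrite -sum_between_sets; last by apply/subsetP => z /has_afterP[].
pose P (K : ideal) := [&& val I \subset val K, val K \subset val J,
                has_after r c g \subset val K :\: val I
              & val K :\: val I \subset g :\: has_before c r g].
rewrite (bigID P) /= [X in _ + X]big1 ?addr0; last first.
  move=> K; rewrite /P /kernel => nP.
  case: ifP => [/andP[IK tc]|]; last by rewrite mul0r.
  case: ifP => [/andP[KJ tr]|]; last by rewrite mulr0.
  by move: nP; rewrite IK KJ /= -thin_between // tc tr.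
(* The maps [h] and [h'] are inverse to each other on the range of summation; there [ideal_between]
   makes the union an ideal, so the default [I] is not reached. *)
pose h (A : {set T}) : ideal := insubd I (val I :|: A).
pose h' (K : ideal) := val K :\: val I.
have hK (A : {set T}) : has_after r c g \subset A -> A \subset g :\: has_before c r g ->
    val (h A) = val I :|: A /\ h' (h A) = A.
  move=> aft bef; rewrite /h' /h insubdK; last exact: (ideal_between pl aft bef).
  split=> //; rewrite setDUl setDv set0U; apply/setDidPl.
  rewrite disjoint_subset; apply/subsetP => z /(subsetP bef).
  by rewrite !inE => /andP[_ /andP[]].
rewrite (reindex_onto h h') /=; last first.
  move=> K /and4P[IK KJ aft bef]; apply/val_inj; rewrite (hK _ aft bef).1 /h'.
  by apply/setP => z; rewrite !inE; have := subsetP IK z;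
     case: (z \in val I) => //= ->.
apply: eq_big => A.
  apply/andP/andP => [[/and4P[_ _ aft bef] /eqP e]|[aft bef]].
    by rewrite /h' in e; rewrite e in aft bef.
  have [eA eh] := hK _ aft bef; rewrite eh; split=> //.
  apply/and4P; rewrite -/(h' (h A)) eh; split=> //; rewrite eA ?subsetUl //.
  rewrite subUset IJ; apply/subsetP => z /(subsetP bef).
  by rewrite !inE => /andP[_ /andP[]].
case/andP=> /and4P[IK KJ aft bef] /eqP e.
have := thin_between pl IK KJ; rewrite /= aft bef /= => /andP[tc tr].
rewrite /kernel IK KJ tc tr /=; rewrite -/(h' (h A)) e; congr (_ * _ ^+ #|pred_of_set _|).
have [-> _] : val (h A) = val I :|: A /\ h' (h A) = A by apply: hK; rewrite -e.
by rewrite -setDDl.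
Qed.

(** Both orders evaluate by [prod_two_sets]; the exponents agree by [card_has_after] and the
    vanishing conditions by [has_corner]. *)
Lemma kernel_convC (r c : T -> int) (x y : R) (I J : ideal) : planar le r c ->
  \sum_K kernel c x I K * kernel r y K J = \sum_K kernel r y I K * kernel c x K J.
Proof.
move=> pl; have pl' := planar_tr pl; rewrite !kernel_convE //.
case: ifP => // IJ; set g := val J :\: val I.
have sA r1 c1 : has_after r1 c1 g \subset g by apply/subsetP => z /has_afterP[].
have sB r1 c1 : has_before r1 c1 g \subset g by apply/subsetP => z /has_beforeP[].
rewrite !prod_two_sets //.
have inj := planar_inj pl; have inj' := planar_inj pl'.
rewrite (card_has_after g inj) (card_has_after g inj').
have -> : (has_after r c g :&: has_before c r g == set0) =
          (has_after c r g :&: has_before r c g == set0).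
  apply/idP/idP; apply: contraTT => /set0Pn[z]; rewrite in_setI => /andP[zA zB].
    by have [q qg] := has_corner pl' zA zB; apply/set0Pn; exists q; rewrite setIC.
  by have [q qg] := has_corner pl zA zB; apply/set0Pn; exists q; rewrite setIC.
case: ifP => // _; rewrite [y + x]addrC [(#|has_before c r g| + _)%N]addnC.
by congr (_ * _); rewrite mulrC.
Qed.

(** If [I] is strictly inside [J], the free cell from [has_end] contributes the factor [x - x]. *)
Lemma kernel_convV (r c : T -> int) (x : R) (I J : ideal) : planar le r c ->
  \sum_K kernel c x I K * kernel r (- x) K J = (I == J)%:R.
Proof.
move=> pl; rewrite kernel_convE //; case: ifP => IJ; last first.
  by case: eqP => // eIJ; rewrite eIJ subxx in IJ.
set g := val J :\: val I; have [g0|gn0] := eqVneq g set0.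
  rewrite g0 big_set0; case: eqP => // -[]; apply/val_inj/eqP.
  by rewrite eqEsubset IJ -setD_eq0 -/g g0 eqxx.
have [z [zg /negbTE zA /negbTE zB]] := has_end r c gn0.
rewrite (bigD1 z) //= zA zB !mul1r subrr mul0r; case: eqP => // e.
by rewrite /g e setDv eqxx in gn0.
Qed.

Definition transfer (c : T -> int) (x : R) : 'M[R]_#|{: ideal}| :=
  \matrix_(i, j) kernel c x (enum_val i) (enum_val j).

Lemma transfer_mulE (r c : T -> int) (x y : R) :
  transfer c x *m transfer r y =
  \matrix_(i, j) \sum_K kernel c x (enum_val i) K * kernel r y K (enum_val j).
Proof.
apply/matrixP => i j; rewrite !mxE [RHS]big_enum_val /=.
by apply: eq_bigr => k _; rewrite !mxE.
Qed.

Lemma transferC (r c : T -> int) (x y : R) : planar le r c ->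
  transfer c x *m transfer r y = transfer r y *m transfer c x.
Proof.
move=> pl; rewrite !transfer_mulE; apply/matrixP => i j; rewrite !mxE.
exact: kernel_convC.
Qed.

Lemma transferV (r c : T -> int) (x : R) : planar le r c ->
  transfer c x *m transfer r (- x) = 1%:M.
Proof.
move=> pl; rewrite transfer_mulE; apply/matrixP => i j; rewrite !mxE kernel_convV //.
by rewrite (inj_eq enum_val_inj).
Qed.

(* The vertical transfer matrix at [- y] is the inverse of the horizontal one at
   [y], so whatever commutes with the former commutes with the latter. *)
Lemma transferCC (r c : T -> int) (x y : R) : planar le r c ->
  transfer c x *m transfer c y = transfer c y *m transfer c x.
Proof.
move=> pl; have Vl := transferV y pl.
have Vr : transfer r (- y) *m transfer c y = 1%:M by rewrite -transferC.
rewrite -[transfer c x in LHS]mul1mx -Vl -!mulmxA; congr (_ *m _).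
by rewrite mulmxA -(transferC _ _ pl) -mulmxA Vr mulmx1.
Qed.

Lemma transfer_comm (r c : T -> int) (a b : bool * R) : planar le r c ->
  transfer (if a.1 then r else c) a.2 *m transfer (if b.1 then r else c) b.2 =
  transfer (if b.1 then r else c) b.2 *m transfer (if a.1 then r else c) a.2.
Proof.
move=> pl; have pl' := planar_tr pl.
by case: a b => [[] x] [[] y] /=; [apply: transferCC pl'|apply: transferC pl'
  |apply: transferC pl|apply: transferCC pl].
Qed.

End Transfer.
End Ideals.

(** * Fillings *)

Definition line (T : Type) (r c : T -> int) : rel T :=
  fun x y => (r x == r y) && (c x < c y).

Definition before (t : pred nat) (a b : nat) : bool :=
  (a < b)%N || ((a == b) && t a).

Lemma before_leq (t : pred nat) (a b : nat) : before t a b -> (a <= b)%N.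
Proof. by case/orP=> [/ltnW|/andP[/eqP ->]]. Qed.

(* [ty k] says that the letter [k] is marked, i.e. occurs at most once per row;
   the other letters occur at most once per column. *)
Definition filling (T : finType) (rl cl : rel T) (m : nat) (ty : pred nat)
    (f : {ffun T -> 'I_m}) : bool :=
  [forall x, forall y, (rl x y ==> before (predC ty) (f x) (f y)) &&
                       (cl x y ==> before ty (f x) (f y))].

Lemma fillingP (T : finType) (rl cl : rel T) (m : nat) (ty : pred nat)
    (f : {ffun T -> 'I_m}) :
  reflect (forall x y, (rl x y -> before (predC ty) (f x) (f y)) /\
                       (cl x y -> before ty (f x) (f y)))
          (filling rl cl ty f).
Proof.
apply: (iffP forallP) => [h x y|h x].
  by have /forallP/(_ y)/andP[/implyP h1 /implyP h2] := h x; split.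
by apply/forallP => y; have [h1 h2] := h x y; apply/andP; split; apply/implyP.
Qed.

Definition fillsum (R : comNzRingType) (T : finType) (rl cl : rel T) (m : nat)
    (ty : pred nat) (vr : nat -> R) : R :=
  \sum_(f : {ffun T -> 'I_m} | filling rl cl ty f) \prod_x vr (f x).

Section PartialFillings.
Variables (R : comNzRingType) (T : finType) (le : rel T) (r c : T -> int).
Hypothesis pl : planar le r c.
Variables (m : nat) (d : 'I_m) (ty : pred nat) (vr : nat -> R).

Local Notation ideal := {J : {set T} | is_ideal le J}.

(* Fillings of [J] by letters below [k], extended by the dummy value [d]. *)
Definition partial_filling (k : nat) (J : {set T}) (f : {ffun T -> 'I_m}) : bool :=
  [forall x, if x \in J then (f x < k)%N else f x == d] &&
  [forall x in J, forall y in J,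
     (line r c x y ==> before (predC ty) (f x) (f y)) &&
     (line c r x y ==> before ty (f x) (f y))].

Lemma partial_fillingP (k : nat) (J : {set T}) (f : {ffun T -> 'I_m}) :
  reflect [/\ forall x, x \in J -> (f x < k)%N, forall x, x \notin J -> f x = d
            & forall x y, x \in J -> y \in J ->
                (line r c x y -> before (predC ty) (f x) (f y)) /\
                (line c r x y -> before ty (f x) (f y))]
          (partial_filling k J f).
Proof.
apply: (iffP andP) => [[/forallP h1 /forall_inP h2]|[h1 h2 h3]].
  split=> [x xJ|x xJ|x y xJ yJ]; first by have := h1 x; rewrite xJ.
    by have := h1 x; rewrite (negbTE xJ) => /eqP.
  by have /forall_inP/(_ y yJ)/andP[/implyP ? /implyP ?] := h2 x xJ.
split; first by apply/forallP => x; case: ifP => [/h1|/negbT/h2 ->].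
apply/forall_inP => x xJ; apply/forall_inP => y yJ.
by have [? ?] := h3 x y xJ yJ; apply/andP; split; apply/implyP.
Qed.

Definition partial_sum (k : nat) (J : {set T}) : R :=
  \sum_(f | partial_filling k J f) \prod_(x in J) vr (f x).

Lemma partial_sum0 (J : {set T}) : partial_sum 0 J = (J == set0)%:R.
Proof.
rewrite /partial_sum; have [->|/set0Pn[x xJ]] := eqVneq; last first.
  by apply: big1 => f /partial_fillingP[/(_ _ xJ)]; rewrite ltn0.
rewrite (big_pred1 [ffun=> d]) ?big_set0 // => f.
apply/partial_fillingP/eqP => [[_ h _]|->].
  by apply/ffunP => x; rewrite ffunE h ?inE.
by split=> [x|x _|x y]; rewrite ?inE ?ffunE.
Qed.

Lemma ideal_set0 : is_ideal le set0.
Proof. by apply/is_idealP => x y _; rewrite inE. Qed.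

Definition ideal0 : ideal := exist _ set0 ideal_set0.

(** Entries increase weakly from [x] to [y]: along the row of [x] to the corner [z] in the column of
    [y], then down that column. *)
Lemma below_ideal (k l : nat) (J : ideal) (f : {ffun T -> 'I_m}) :
  partial_filling k (val J) f -> is_ideal le [set x in val J | (f x < l)%N].
Proof.
case/partial_fillingP=> _ _ h; have idJ := is_idealP _ _ (valP J).
apply/is_idealP => x y xy; rewrite !inE => /andP[yJ fy].
have xJ := idJ _ _ xy yJ; rewrite xJ /=.
have [z [rz cz]] := planar_ne pl xy.
move: xy; rewrite (planar_le pl) => /andP[rxy cxy].
have zy : le z y by rewrite (planar_le pl) rz cz rxy lexx.
have zJ := idJ _ _ zy yJ.
have le_fzy : (f z <= f y)%N.
  have [rzy|] := ltP (r z) (r y).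
    by apply: before_leq; apply: (h z y zJ yJ).2; rewrite /line cz eqxx.
  by rewrite rz => ryx; rewrite (planar_inj pl (x := z) (y := y)) //; lia.
have le_fxz : (f x <= f z)%N.
  have [czx|] := ltP (c x) (c z).
    by apply: before_leq; apply: (h x z xJ zJ).1; rewrite /line rz eqxx.
  by rewrite cz => cyx; rewrite (planar_inj pl (x := x) (y := z)) //; lia.
exact: leq_ltn_trans le_fxz (leq_ltn_trans le_fzy fy).
Qed.

(** Fillings are sorted by the ideal [I] of cells with letters below [k]. The other cells all carry
    [k] and form a strip of the kind given by [ty k]. *)
Lemma partial_sumS (k : nat) (J : ideal) : (k < m)%N ->
  partial_sum k.+1 (val J) =
  \sum_I partial_sum k (val I) * kernel (if ty k then r else c) (vr k) I J.
Proof.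
move=> km; pose kk : 'I_m := Ordinal km.
pose g (f : {ffun T -> 'I_m}) : ideal := insubd ideal0 [set x in val J | (f x < k)%N].
have gE f : partial_filling k.+1 (val J) f -> val (g f) = [set x in val J | (f x < k)%N].
  by move=> pf; rewrite /g insubdK //; apply: below_ideal pf.
rewrite /partial_sum (partition_big g predT) //=; apply: eq_bigr => I _.
have top f x : partial_filling k.+1 (val J) f -> g f = I ->
    x \in val J -> x \notin val I -> f x = kk.
  move=> pf <- xJ; rewrite gE // inE xJ /= -leqNgt => kf; apply/val_inj => /=.
  by case/partial_fillingP: pf => /(_ _ xJ) fk _ _; apply/eqP; rewrite eqn_leq kf -ltnS fk.
rewrite /kernel; case: ifP => [/andP[IJ thk]|nIJ]; last first.
  rewrite mulr0; apply: big_pred0 => f; apply/andP => -[pf /eqP gf].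
  have IJ : val I \subset val J.
    by rewrite -gf gE //; apply/subsetP => x; rewrite inE => /andP[].
  move/negP: nIJ; apply; rewrite IJ /=; apply/thinP => x y.
  rewrite !in_setD => /andP[xI xJ] /andP[yI yJ] qxy.
  have fx := top _ _ pf gf xJ xI; have fy := top _ _ pf gf yJ yI.
  case/partial_fillingP: pf => _ _ h.
  (* Two cells outside [I] both carry [k]; on a line where [k] may not be repeated they must
     coincide, so a nonempty sum forces thinness. *)
  have nlt u : before u k k -> u k by rewrite /before ltnn eqxx.
  have [hr hc] := h x y xJ yJ; have [hr' hc'] := h y x yJ xJ.
  move: hr hc hr' hc'; rewrite fx fy /= => hr hc hr' hc'.
  case tk: (ty k) in qxy.
    apply: (planar_inj pl) => //; case: (ltgtP (c x) (c y)) => // lt.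
      have /hr/nlt : line r c x y by rewrite /line qxy eqxx.
    by rewrite /= tk.
    have /hr'/nlt : line r c y x by rewrite /line qxy eqxx.
    by rewrite /= tk.
  apply: (planar_inj pl) => //; case: (ltgtP (r x) (r y)) => // lt.
    have /hc/nlt : line c r x y by rewrite /line qxy eqxx.
    by rewrite /= tk.
  have /hc'/nlt : line c r y x by rewrite /line qxy eqxx.
    by rewrite /= tk.
(* [h] extends a filling of [I] by the letter [k] on the rest of [J]; [h'] forgets these letters
   again, resetting them to the dummy value [d]. *)
pose h (f : {ffun T -> 'I_m}) : {ffun T -> 'I_m} :=
  [ffun x => if x \in val I then f x else if x \in val J then kk else d].
pose h' (f : {ffun T -> 'I_m}) : {ffun T -> 'I_m} :=
  [ffun x => if x \in val I then f x else d].
have IJx x : x \in val I -> x \in val J by apply: (subsetP IJ).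
rewrite mulr_suml (reindex_onto h h') /=; last first.
  move=> f /andP[pf /eqP gf]; apply/ffunP => x; rewrite !ffunE.
  case: (boolP (x \in val I)) => [//|xI]; case: (boolP (x \in val J)) => xJ.
    by rewrite (top _ _ pf gf xJ xI).
  by case/partial_fillingP: pf => _ -> .
apply: eq_big => [f|f _]; last first.
  rewrite (big_setID (val I)) /= (setIidPr IJ); congr (_ * _).
    by apply: eq_bigr => x xI; rewrite ffunE xI.
  rewrite -prodr_const; apply: eq_bigr => x; rewrite inE => /andP[/negbTE xI xJ].
  by rewrite ffunE xI xJ.
apply/idP/partial_fillingP => [/andP[/andP[pf /eqP gf] /eqP hh]|[f1 f2 f3]].
  have hI x : x \in val I -> h f x = f x by move=> xI; rewrite ffunE xI.
  have /partial_fillingP[_ _ h3] := pf; split=> [x xI|x xI|x y xI yI].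
  - by have := xI; rewrite -gf gE // inE hI // => /andP[].
  - by rewrite -hh ffunE (negbTE xI).
  - by rewrite -!hI //; apply: h3; apply: IJx.
have hI x : x \in val I -> h f x = f x by move=> xI; rewrite ffunE xI.
have hJ x : x \in val J -> x \notin val I -> h f x = kk.
  by move=> xJ /negbTE xI; rewrite ffunE xI xJ.
have idI := is_idealP _ _ (valP I).
have pf : partial_filling k.+1 (val J) (h f).
  apply/partial_fillingP; split=> [x xJ|x xJ|x y xJ yJ].
  - case: (boolP (x \in val I)) => xI; last by rewrite hJ /=.
    by rewrite hI // ltnS ltnW // f1.
  - by rewrite ffunE (negbTE xJ) (negbTE (contraNN (IJx x) xJ)).
  case: (boolP (x \in val I)) => xI; case: (boolP (y \in val I)) => yI.
  - by rewrite !hI //; apply: f3.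
  - by rewrite hI // (hJ y) //; split=> _; rewrite /before f1.
  - by split=> /andP[/eqP e lt]; rewrite (idI _ _ _ yI) // in xI;
       rewrite (planar_le pl) e lexx ltW.
  rewrite !hJ //; have tx : x \in val J :\: val I by rewrite inE xI.
  have ty' : y \in val J :\: val I by rewrite inE yI.
  have th := thinP _ _ thk x y tx ty'.
  split=> /andP[/eqP e lt]; rewrite /before ltnn eqxx /=.
    by apply/negP => tk; rewrite tk in th; rewrite (th e) ltxx in lt.
  by apply: contraT => /negbTE tk; rewrite tk in th; rewrite (th e) ltxx in lt.
rewrite pf /=; apply/andP; split; apply/eqP.
  apply/val_inj; rewrite gE //; apply/setP => x; rewrite inE.
  case: (boolP (x \in val I)) => xI; first by rewrite IJx // hI // f1.
  by case: (boolP (x \in val J)) => xJ //=; rewrite hJ //= ltnn.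
apply/ffunP => x; rewrite ffunE; case: ifP => [xI|/negbT xI]; first by rewrite hI.
by rewrite f2.
Qed.

(** The row of the empty ideal in the product of the transfer matrices of the letters of [w]. *)
Definition transfer_word (w : seq (bool * R)) : 'rV[R]_#|{: ideal}| :=
  foldl (fun v a => v *m transfer le (if a.1 then r else c) a.2)
        (delta_mx 0 (enum_rank ideal0)) w.

Lemma partial_sumE (k : nat) (J : ideal) : (k <= m)%N ->
  partial_sum k (val J) =
  transfer_word (mkseq (fun i => (ty i, vr i)) k) 0 (enum_rank J).
Proof.
elim: k J => [|k IH] J km.
  by rewrite partial_sum0 /transfer_word /= mxE eqxx (inj_eq enum_rank_inj).
rewrite partial_sumS // /transfer_word mkseqS -cats1 foldl_cat /= mxE.
rewrite big_enum_val /=; apply: eq_bigr => i _.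
by rewrite IH ?(ltnW km) // mxE enum_valK enum_rankK.
Qed.

Lemma fillsum_transfer :
  fillsum (line r c) (line c r) m ty vr =
  transfer_word (mkseq (fun i => (ty i, vr i)) m) 0
    (enum_rank (exist _ setT (introT (is_idealP le setT) (fun x y _ _ => in_setT x)) : ideal)).
Proof.
rewrite -partial_sumE //=; apply: eq_big => [f|f _]; last first.
  by apply: eq_bigl => x; rewrite inE.
apply/fillingP/partial_fillingP => [h|[_ _ h] x y]; last by apply: h; rewrite inE.
by split=> [x _|x|x y _ _]; rewrite ?ltn_ord ?inE.
Qed.

End PartialFillings.

Theorem fillsum_perm (R : comNzRingType) (T : finType) (le : rel T)
    (r c : T -> int) (m : nat) (ty ty' : pred nat) (vr vr' : nat -> R) :
  planar le r c ->
  perm_eq (mkseq (fun i => (ty i, vr i)) m) (mkseq (fun i => (ty' i, vr' i)) m) ->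
  fillsum (line r c) (line c r) m ty vr = fillsum (line r c) (line c r) m ty' vr'.
Proof.
move=> pl; case: m => [_|m pw].
  (* Without letters there is no dummy value; but then no cell can carry a letter, and both sums
     agree cell by cell vacuously. *)
  apply: eq_big => [f|f _]; last by apply: eq_bigr => x; case: (f x).
  by apply: eq_forallb => x; case: (f x).
rewrite !(fillsum_transfer pl ord0) /transfer_word (foldl_perm _ _ pw) //.
by move=> v a b; rewrite -!mulmxA transfer_comm.
Qed.

(** * Generating functions of diagrams *)

Lemma fillsum_iso (R : comNzRingType) (T T' : finType) (rl cl : rel T)
    (rl' cl' : rel T') (f : T -> T') (m : nat) (ty : pred nat) (vr : nat -> R) :
  bijective f -> (forall x y, rl' (f x) (f y) = rl x y) ->
  (forall x y, cl' (f x) (f y) = cl x y) ->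
  fillsum rl cl m ty vr = fillsum rl' cl' m ty vr.
Proof.
case=> f' fK f'K hr hc.
pose F (h : {ffun T' -> 'I_m}) : {ffun T -> 'I_m} := [ffun x => h (f x)].
pose F' (h : {ffun T -> 'I_m}) : {ffun T' -> 'I_m} := [ffun y => h (f' y)].
have FK : cancel F F' by move=> h; apply/ffunP => y; rewrite !ffunE f'K.
have F'K : cancel F' F by move=> h; apply/ffunP => y; rewrite !ffunE fK.
rewrite /fillsum (reindex F); last by exists F' => h _.
apply: eq_big => [h|h _].
  apply/fillingP/fillingP => H x y; last by rewrite -hr -hc !ffunE.
  by have := H (f' x) (f' y); rewrite !ffunE -hr -hc !f'K.
rewrite [RHS](reindex f) /=; last by exists f' => x _.
by apply: eq_bigr => x _; rewrite ffunE.
Qed.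

Definition fstz (T : Type) (p : T -> cell) : T -> int := fun x => (p x).1.
Definition sndz (T : Type) (p : T -> cell) : T -> int := fun x => (p x).2.

(** The property of skew diagrams from [skew_convex]. It passes to strings and variants without
    exhibiting partitions for them. *)
Definition convex (D : diagram) : Prop := forall i j i' j' a b : int,
  (i, j) \in D -> (i', j') \in D -> i <= a <= i' -> j <= b <= j' -> (a, b) \in D.

Lemma transposeP (D : diagram) (c : cell) : (c \in transpose D) = ((c.2, c.1) \in D).
Proof.
by apply/imfsetP/idP => [[[a b] /= dD ->]|cD] //; exists (c.2, c.1); case: c cD.
Qed.

Lemma rotateP (D : diagram) (c : cell) : (c \in rotate D) = ((- c.1, - c.2) \in D).
Proof.
apply/imfsetP/idP => [[[a b] /= dD ->]|cD] /=; first by rewrite !opprK.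
by exists (- c.1, - c.2) => //=; rewrite !opprK; case: c {cD}.
Qed.

Lemma transposeK : involutive transpose.
Proof. by move=> D; apply/fsetP => -[a b]; rewrite !transposeP. Qed.

Lemma convex_translate (v : cell) (D : diagram) : convex D -> convex (translate v D).
Proof.
move=> cD i j i' j' a b; rewrite !translateP /= => h1 h2 ha hb.
by apply: cD h1 h2 _ _; lia.
Qed.

Lemma convex_transpose (D : diagram) : convex D -> convex (transpose D).
Proof.
by move=> cD i j i' j' a b; rewrite !transposeP /= => h1 h2 ha hb; apply: cD h1 h2 _ _.
Qed.

Lemma convex_rotate (D : diagram) : convex D -> convex (rotate D).
Proof.
move=> cD i j i' j' a b; rewrite !rotateP /= => h1 h2 ha hb.
by apply: cD h2 h1 _ _; lia.
Qed.

Lemma planar_convex (D : diagram) : convex D ->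
  planar (fun x y : D => ((val x).1 <= (val y).1) && ((val x).2 <= (val y).2))
         (fstz (val : D -> cell)) (sndz (val : D -> cell)).
Proof.
move=> cD; split=> //.
- by move=> x y rxy cxy; apply/val_inj/eqP; rewrite -pair_eqE; apply/andP; split; apply/eqP.
- move=> [[a b] /= xD] [[a' b'] /= yD] /= /andP[ha hb].
  have zD : (a, b') \in D by apply: cD xD yD _ _; rewrite lexx ?andbT.
  by exists [` zD].
- move=> [[a b] /= xD] [[a' b'] /= yD] /= /andP[ha hb].
  have zD : (a', b) \in D by apply: cD xD yD _ _; rewrite lexx ?andbT.
  by exists [` zD].
Qed.

Section Schur.
Variables (R : comNzRingType) (m : nat) (ty : pred nat) (vr : nat -> R).

(** Parametrising cells by an arbitrary finite type allows images of [D] and glued diagrams to be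
    filled on the original cells. *)
Definition cellsum (T : finType) (p : T -> cell) : R :=
  fillsum (line (fstz p) (sndz p)) (line (sndz p) (fstz p)) m ty vr.

Definition schur (D : diagram) : R := cellsum (val : D -> cell).

Lemma cellsum_schur (T : finType) (p : T -> cell) (D : diagram) :
  injective p -> (forall x, p x \in D) -> (forall c, c \in D -> exists x, p x = c) ->
  cellsum p = schur D.
Proof.
move=> pI pD Dp; pose f (x : T) : D := [` pD x].
apply: (@fillsum_iso _ _ _ _ _ _ _ f) => //.
apply: inj_card_bij => [x y /(congr1 val)/pI //|].
rewrite -(@card_codom _ _ f); last by move=> x y /(congr1 val)/pI.
apply/subset_leq_card/subsetP => -[c cD] _; have [x px] := Dp _ cD.
by apply/codomP; exists x; apply/val_inj.
Qed.

Lemma schur_translate (v : cell) (D : diagram) : schur (translate v D) = schur D.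
Proof.
pose p (x : D) : cell := ((val x).1 + v.1, (val x).2 + v.2).
rewrite -(@cellsum_schur _ p).
- apply: (@fillsum_iso _ _ _ _ _ _ _ id); first by exists id.
    by move=> x y; rewrite /line /fstz /sndz /= (inj_eq (@addIr _ _)) ltrD2r.
  by move=> x y; rewrite /line /fstz /sndz /= (inj_eq (@addIr _ _)) ltrD2r.
- move=> x y [] /addIr e1 /addIr e2; apply/val_inj/eqP.
  by rewrite -pair_eqE /pair_eq /= e1 e2 !eqxx.
- by move=> x; rewrite translateP /= !addrK -surjective_pairing; apply: valP.
- move=> c; rewrite translateP => cD; exists [` cD].
  by rewrite /p /= !subrK -surjective_pairing.
Qed.

(** Rotation reverses all lines, so reversing the alphabet turns fillings of the rotated diagram
    into fillings of [D]; [fillsum_perm] restores the order of the letters. *)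
Lemma schur_rotate (D : diagram) : convex D -> schur (rotate D) = schur D.
Proof.
move=> cD; pose p (x : D) : cell := (- (val x).1, - (val x).2).
rewrite -(@cellsum_schur _ p); first last.
- by move=> c; rewrite rotateP => H; exists [` H]; rewrite /p /= !opprK -surjective_pairing.
- by move=> x; rewrite rotateP /= !opprK -surjective_pairing; apply: valP.
- move=> x y [] /oppr_inj e1 /oppr_inj e2; apply/val_inj/eqP.
  by rewrite -pair_eqE /pair_eq /= e1 e2 !eqxx.
pose rv k := (m - k.+1)%N.
transitivity (fillsum (line (fstz (val : D -> cell)) (sndz (val : D -> cell)))
  (line (sndz (val : D -> cell)) (fstz (val : D -> cell))) m (ty \o rv) (vr \o rv)).
  pose F (f : {ffun D -> 'I_m}) : {ffun D -> 'I_m} := [ffun x => rev_ord (f x)].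
  have FK : involutive F by move=> f; apply/ffunP => x; rewrite !ffunE rev_ordK.
  rewrite /cellsum /fillsum (reindex_inj (inv_inj FK)) /=; apply: eq_big => [f|f _].
    have before_rv u (a b : 'I_m) :
        before u (rev_ord a) (rev_ord b) = before (u \o rv) b a.
      rewrite /before /= /rv; congr (_ || _); first by case: a b => a ? [b ?] /=; lia.
      case: (eqVneq (b : nat) a) => [->|]; first by rewrite eqxx.
      by case: a b => a ? [b ?] /= ne; case: eqP => //; lia.
    have lr x y : line (fstz p) (sndz p) x y =
        line (fstz (val : D -> cell)) (sndz (val : D -> cell)) y x.
      by rewrite /line /fstz /sndz /= (inj_eq oppr_inj) ltrN2 eq_sym.
    have lc x y : line (sndz p) (fstz p) x y =
        line (sndz (val : D -> cell)) (fstz (val : D -> cell)) y x.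
      by rewrite /line /fstz /sndz /= (inj_eq oppr_inj) ltrN2 eq_sym.
    by apply/fillingP/fillingP => H x y; have := H y x;
       rewrite !ffunE !before_rv lr lc.
  by apply: eq_bigr => x _; rewrite ffunE.
apply: fillsum_perm (planar_convex cD) _.
have -> : mkseq (fun i => ((ty \o rv) i, (vr \o rv) i)) m =
          rev (mkseq (fun i => (ty i, vr i)) m); last by rewrite perm_rev.
apply: (@eq_from_nth _ (true, 0)); rewrite ?size_rev !size_mkseq // => i im.
by rewrite nth_rev !size_mkseq // !nth_mkseq // /rv; lia.
Qed.

(** Transposition exchanges the row and column conditions, that is, the two kinds of letters. *)
Lemma schur_transpose (D : diagram) : convex D ->
  perm_eq (mkseq (fun i => (ty i, vr i)) m) (mkseq (fun i => (~~ ty i, vr i)) m) ->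
  schur (transpose D) = schur D.
Proof.
move=> cD pw; pose p (x : D) : cell := ((val x).2, (val x).1).
rewrite -(@cellsum_schur _ p); first last.
- by move=> c; rewrite transposeP => H; exists [` H]; rewrite /p /= -surjective_pairing.
- by move=> x; rewrite transposeP /= -surjective_pairing; apply: valP.
- by move=> x y [] e1 e2; apply/val_inj/eqP; rewrite -pair_eqE /pair_eq /= e1 e2 !eqxx.
rewrite [RHS](fillsum_perm (planar_convex cD) pw).
apply: eq_bigl => f; apply/fillingP/fillingP => H x y; have [h1 h2] := H x y;
  split=> [/h2|/h1]; rewrite /before //=; by rewrite negbK.
Qed.

End Schur.

(** * Weakly amenable tableaux *)

(* The letter (i+1)' is encoded as [2 i] and the letter i+1 as [2 i + 1]. *)
Definition marked : pred nat := fun k => ~~ odd k.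

(** The codes [2 i] and [2 i + 1] share one variable; the value 0 occurs only for codes beyond the
    alphabet. *)
Definition xvar (n k : nat) : {mpoly int[n]} :=
  if insub k./2 is Some i then 'X_i else 0.

Definition schurQ_poly (n : nat) : diagram -> {mpoly int[n]} :=
  schur n.*2 marked (xvar n).

(** Flipping all marks just swaps the two letters of each pair, as they have the same value. *)
Lemma perm_marked (R : eqType) (v : nat -> R) (n : nat) :
  perm_eq (mkseq (fun i => (marked i, v i./2)) n.*2)
          (mkseq (fun i => (~~ marked i, v i./2)) n.*2).
Proof.
elim: n => [|n IH] //; rewrite doubleS !mkseqS -!cats1 -!catA perm_cat //.
by rewrite /marked /= odd_double /= uphalf_double doubleK (perm_catC [:: _] [:: _]).
Qed.

Lemma schurQ_poly_transpose (n : nat) (D : diagram) : convex D ->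
  schurQ_poly n (transpose D) = schurQ_poly n D.
Proof.
move=> cD; apply: schur_transpose cD _.
exact: (perm_marked (fun k => if insub k is Some i then 'X_i else 0 : {mpoly int[n]})).
Qed.

Definition letter_code (n : nat) (a : 'I_n * bool) : nat := (a.1.*2 + ~~ a.2)%N.

Lemma ltn_letter_code (n : nat) (a : 'I_n * bool) : (letter_code a < n.*2)%N.
Proof. by case: a => -[i ilt] b; rewrite /letter_code /=; case: b => /=; lia. Qed.

Definition encode (n : nat) (a : 'I_n * bool) : 'I_n.*2 := Ordinal (ltn_letter_code a).

Lemma letter_code_half (n : nat) (a : 'I_n * bool) : (letter_code a)./2 = a.1.
Proof. by rewrite /letter_code addnC halfD odd_double andbF doubleK; case: a.2. Qed.

Lemma marked_code (n : nat) (a : 'I_n * bool) : marked (letter_code a) = a.2.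
Proof. by rewrite /marked /letter_code oddD odd_double; case: a.2. Qed.

Lemma letter_leE (n : nat) (a b : 'I_n * bool) :
  letter_le a b = (letter_code a <= letter_code b)%N.
Proof.
case: a b => [[i ?] s] [[j ?] t]; rewrite /letter_le /letter_code -val_eqE /=.
by case: s; case: t => /=; lia.
Qed.

Lemma encode_inj (n : nat) : injective (@encode n).
Proof.
move=> a b /(congr1 val) /= e.
have := letter_code_half a; have := marked_code a.
rewrite e marked_code letter_code_half; case: a b {e} => [i s] [j t] /= -> e.
by congr (_, _); apply/val_inj.
Qed.

(** Weak increase together with the bound on repetitions means that two entries on a line increase
    strictly unless they are equal letters of the kind allowed to repeat there. *)
Lemma weakly_amenableE (D : diagram) (n : nat) (T : {ffun D -> 'I_n * bool}) :
  weakly_amenable T =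
  filling (line (fstz (val : D -> cell)) (sndz (val : D -> cell)))
          (line (sndz (val : D -> cell)) (fstz (val : D -> cell))) marked
          [ffun x => encode (T x)].
Proof.
have eqc (x y : D) : T x = T y -> letter_code (T x) = letter_code (T y) by move=> ->.
have ceq (x y : D) : letter_code (T x) = letter_code (T y) -> T x = T y.
  by move=> e; apply: encode_inj; apply/val_inj.
have vinj (x y : D) : (val x).1 = (val y).1 -> (val x).2 = (val y).2 -> x = y.
  by move=> e1 e2; apply/val_inj/eqP; rewrite -pair_eqE; apply/andP; split; apply/eqP.
apply/and4P/fillingP => [[h1 h2 h3 h4] x y|h].
  have {h1} := forallP (forallP h1 x) y; have {h2} := forallP (forallP h2 x) y.
  have {h3} := forallP (forallP h3 x) y; have {h4} := forallP (forallP h4 x) y.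
  rewrite /same_row /same_col !ffunE /before /line /fstz /sndz /= !letter_leE marked_code.
  move=> h4 h3 h2 h1; split=> /andP[e lt].
    move: h1 h3; rewrite e ltW //= => le /implyP h3; rewrite leq_eqVlt in le.
    case/orP: le => [|->] //; move=> /eqP cxy; rewrite cxy ltnn eqxx /=.
    apply: contraT; rewrite negbK => mk.
    by move: lt; rewrite (eqP (h3 _)) ?ltxx // (ceq _ _ cxy) eqxx -(ceq _ _ cxy).
  move: h2 h4; rewrite e ltW //= => le /implyP h4; rewrite leq_eqVlt in le.
  case/orP: le => [|->] //; move=> /eqP cxy; rewrite cxy ltnn eqxx /=.
  apply: contraT => mk.
  by move: lt; rewrite (eqP (h4 _)) ?ltxx // (ceq _ _ cxy) eqxx -(ceq _ _ cxy).
have hr x y : (val x).1 = (val y).1 -> (val x).2 < (val y).2 ->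
    before (predC marked) (letter_code (T x)) (letter_code (T y)).
  by move=> e lt; have [+ _] := h x y; rewrite !ffunE /line /fstz /sndz e eqxx lt => /(_ isT).
have hc x y : (val x).2 = (val y).2 -> (val x).1 < (val y).1 ->
    before marked (letter_code (T x)) (letter_code (T y)).
  by move=> e lt; have [_ +] := h x y; rewrite !ffunE /line /fstz /sndz e eqxx lt => /(_ isT).
split; apply/forallP => x; apply/forallP => y; apply/implyP.
- case/andP=> /eqP e; rewrite le_eqVlt => /orP[/eqP e2|lt]; rewrite letter_leE.
    by rewrite (vinj x y e e2).
  exact: before_leq (hr _ _ e lt).
- case/andP=> /eqP e; rewrite le_eqVlt => /orP[/eqP e2|lt]; rewrite letter_leE.
    by rewrite (vinj x y e2 e).
  exact: before_leq (hc _ _ e lt).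
- case/and3P=> /eqP e /eqP eT mk; apply/eqP; apply: vinj => //.
  case: (ltgtP (val x).2 (val y).2) => // lt.
    by have := hr _ _ e lt; rewrite /before /= -eT ltnn eqxx marked_code mk.
  by have := hr _ _ (esym e) lt; rewrite /before /= -eT ltnn eqxx marked_code mk.
- case/and3P=> /eqP e /eqP eT mk; apply/eqP; apply: vinj => //.
  case: (ltgtP (val x).1 (val y).1) => // lt.
    by have := hc _ _ e lt; rewrite /before /= -eT ltnn eqxx marked_code (negbTE mk).
  by have := hc _ _ (esym e) lt; rewrite /before /= -eT ltnn eqxx marked_code (negbTE mk).
Qed.

(** Encoding letters is a bijection from tableaux to fillings, and the exponent vector of the weight
    of a filling is the content of the tableau. *)
Lemma tableau_seriesE (D : diagram) (s : seq nat) :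
  ((tableau_series D s)%:R : int) =
  (schurQ_poly (size s) D)@_[multinom nth 0%N s i | i < size s].
Proof.
set n := size s; set M := [multinom _ | i < n].
rewrite /schurQ_poly /schur /cellsum /fillsum raddf_sum /=.
pose F (T : {ffun D -> 'I_n * bool}) : {ffun D -> 'I_n.*2} := [ffun x => encode (T x)].
have enc_bij : bijective (@encode n).
  apply: inj_card_bij; first exact: encode_inj.
  by rewrite card_prod !card_ord card_bool muln2.
have [dec encK decK] := enc_bij.
pose F' (f : {ffun D -> 'I_n.*2}) : {ffun D -> 'I_n * bool} := [ffun x => dec (f x)].
have FK : cancel F F' by move=> T; apply/ffunP => x; rewrite !ffunE encK.
have F'K : cancel F' F by move=> T; apply/ffunP => x; rewrite !ffunE decK.
rewrite (reindex F) /=; last by exists F' => f _.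
rewrite /tableau_series -/n -sum1_card natr_sum /= big_mkcondr /=.
apply: eq_big => [T|T _]; first by rewrite weakly_amenableE.
have -> : \prod_x xvar n (F T x) = 'X_[\sum_x U_((T x).1)].
  rewrite -mprodXE; apply: eq_bigr => x _; rewrite ffunE /xvar /= letter_code_half.
  by rewrite valK.
rewrite mcoeffX; have -> : (\sum_x U_((T x).1) == M)%MM = [forall i, content T i == nth 0%N s i].
  have cE i : (\sum_x U_((T x).1))%MM i = content T i.
    rewrite mnm_sumE /content -sum1_card [RHS]big_mkcond /=.
    by apply: eq_bigr => x _; rewrite mnm1E inE; case: eqP.
  apply/eqP/forallP => [e i|h]; first by rewrite -cE e mnmE.
  by apply/mnmP => i; rewrite cE mnmE; apply/eqP.
by case: ifP.
Qed.

(** * Concatenation and the product rule *)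

(* [p] is the north-east and [q] the south-west corner of the bounding box. *)
Record corners (D : diagram) (p q : cell) : Prop := Corners {
  corner_ne : p \in D;
  corner_sw : q \in D;
  corner_row : forall c, c \in D -> p.1 <= c.1 <= q.1;
  corner_col : forall c, c \in D -> q.2 <= c.2 <= p.2 }.

(** By convexity a topmost and a rightmost cell yield the corner [p], a leftmost and a lowest cell
    the corner [q]. *)
Lemma convex_corners (D : diagram) : convex D -> D != fset0 ->
  exists p q, corners D p q.
Proof.
move=> cD /fset0Pn[c0 c0D]; pose x0 : D := [` c0D].
case: (@arg_minP _ _ _ x0 predT (fun x : D => (val x).1) isT) => t _ ht.
case: (@arg_maxP _ _ _ x0 predT (fun x : D => (val x).1) isT) => b _ hb.
case: (@arg_minP _ _ _ x0 predT (fun x : D => (val x).2) isT) => l _ hl.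
case: (@arg_maxP _ _ _ x0 predT (fun x : D => (val x).2) isT) => r _ hr.
have mem (x : D) : ((val x).1, (val x).2) \in D by rewrite -surjective_pairing; apply: valP.
exists ((val t).1, (val r).2), ((val b).1, (val l).2); split.
- by apply: cD (mem t) (mem r) _ _; rewrite lexx ?andbT; [apply: ht|apply: hr].
- by apply: cD (mem l) (mem b) _ _; rewrite lexx ?andbT; [apply: hb|apply: hl].
- by move=> c cD' /=; rewrite (ht [` cD'] isT); apply: (hb [` cD'] isT).
- by move=> c cD' /=; rewrite (hl [` cD'] isT); apply: (hr [` cD'] isT).
Qed.

Lemma corners_translate (v : cell) (D : diagram) (p q : cell) : corners D p q ->
  corners (translate v D) (p.1 + v.1, p.2 + v.2) (q.1 + v.1, q.2 + v.2).
Proof.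
case=> pD qD hr hc; split; rewrite ?translateP /= ?addrK -?surjective_pairing //.
  by move=> c; rewrite translateP => /hr /=; lia.
by move=> c; rewrite translateP => /hc /=; lia.
Qed.

Lemma corners_transpose (D : diagram) (p q : cell) : corners D p q ->
  corners (transpose D) (q.2, q.1) (p.2, p.1).
Proof.
case=> pD qD hr hc; split; rewrite ?transposeP /= -?surjective_pairing //.
  by move=> c; rewrite transposeP => /hc.
by move=> c; rewrite transposeP => /hr.
Qed.

Lemma corners_rotate (D : diagram) (p q : cell) : corners D p q ->
  corners (rotate D) (- q.1, - q.2) (- p.1, - p.2).
Proof.
case=> pD qD hr hc; split; rewrite ?rotateP /= ?opprK -?surjective_pairing //.
  by move=> c; rewrite rotateP => /hr /=; lia.
by move=> c; rewrite rotateP => /hc /=; lia.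
Qed.

(* The south-west corner of the left operand of [s] relative to the north-east
   corner of the right one. *)
Definition delta (s : star) : cell :=
  match s with Dot => (-1, 0) | Odot => (0, 1) end.

Definition offset (s : star) (p2 q1 : cell) : cell :=
  (p2.1 + (delta s).1 - q1.1, p2.2 + (delta s).2 - q1.2).

Section StarOp.
Variables (s : star) (D1 D2 : diagram) (p1 q1 p2 q2 : cell).
Hypotheses (k1 : corners D1 p1 q1) (k2 : corners D2 p2 q2).

Let v := offset s p2 q1.

Lemma star_opE : star_op s D1 D2 = translate v D1 `|` D2.
Proof.
have bt : bottom D1 = q1.1.
  by apply: (@big_maxE _ (fun c : cell => c.1) _ (corner_sw k1)) => c /(corner_row k1)/andP[].
have lf : left_ D1 = q1.2.
  by apply: (@big_minE _ (fun c : cell => c.2) _ (corner_sw k1)) => c /(corner_col k1)/andP[].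
have tp : top D2 = p2.1.
  by apply: (@big_minE _ (fun c : cell => c.1) _ (corner_ne k2)) => c /(corner_row k2)/andP[].
have rt : right_ D2 = p2.2.
  by apply: (@big_maxE _ (fun c : cell => c.2) _ (corner_ne k2)) => c /(corner_col k2)/andP[].
apply/fsetP => c; rewrite /v /offset.
by case: s => /=; rewrite /concat /near_concat /place_ne !in_fsetU !translateP /= bt lf tp rt;
  congr (in_mem (_, _) _ || _); lia.
Qed.

Lemma in_star_op (c : cell) :
  (c \in star_op s D1 D2) = ((c.1 - v.1, c.2 - v.2) \in D1) || (c \in D2).
Proof. by rewrite star_opE in_fsetU translateP. Qed.

Lemma corners_star_op :
  corners (star_op s D1 D2) (p1.1 + v.1, p1.2 + v.2) q2.
Proof.
have [p1D q1D hr1 hc1] := k1; have [p2D q2D hr2 hc2] := k2.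
have := hr1 _ p1D; have := hc1 _ p1D; have := hr2 _ p2D; have := hc2 _ p2D => b1 b2 b3 b4.
split.
- by rewrite in_star_op /= !addrK -surjective_pairing p1D.
- by rewrite in_star_op q2D orbT.
- move=> c; rewrite in_star_op => /orP[/hr1|/hr2]; rewrite /v /offset /=;
    by case: s => /=; lia.
- move=> c; rewrite in_star_op => /orP[/hc1|/hc2]; rewrite /v /offset /=;
    by case: s => /=; lia.
Qed.

(** Cells of different operands are comparable only in the column (for [Dot]) or row (for [Odot])
    through the junction, where the two corner cells cut the interval between them into one interval
    per operand. *)
Lemma convex_star_op : convex D1 -> convex D2 -> convex (star_op s D1 D2).
Proof.
move=> c1 c2 i j i' j' a b.
have [p1D q1D hr1 hc1] := k1; have [p2D q2D hr2 hc2] := k2.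
rewrite !in_star_op /= => /orP[xD|xD] /orP[yD|yD] ha hb.
- by apply/orP; left; apply: c1 xD yD _ _; lia.
- have := hr1 _ xD; have := hc1 _ xD; have := hr2 _ yD; have := hc2 _ yD.
  move: xD; rewrite /v /offset /=; case: s => /= xD h1 h2 h3 h4; last by lia.
  case: (lerP p2.1 a) => ap; apply/orP; [right|left].
    by rewrite [p2]surjective_pairing in p2D; apply: c2 p2D yD _ _; lia.
  by rewrite [q1]surjective_pairing in q1D; apply: c1 xD q1D _ _; lia.
- have := hr2 _ xD; have := hc2 _ xD; have := hr1 _ yD; have := hc1 _ yD.
  move: yD; rewrite /v /offset /=; case: s => /= yD h1 h2 h3 h4; first by lia.
  case: (lerP b p2.2) => bp; apply/orP; [right|left].
    by rewrite [p2]surjective_pairing in p2D; apply: c2 xD p2D _ _; lia.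
  by rewrite [q1]surjective_pairing in q1D; apply: c1 q1D yD _ _; lia.
- by apply/orP; right; apply: c2 xD yD _ _.
Qed.

End StarOp.

Lemma before_trans (t : pred nat) (a b c : nat) :
  before t a b -> before t b c -> before t a c.
Proof.
rewrite /before => /orP[ab|/andP[/eqP -> tb]] // /orP[bc|/andP[/eqP <- _]].
- by rewrite (ltn_trans ab bc).
- by rewrite ab.
Qed.

Lemma before_chain (T : Type) (g : T -> nat) (t : pred nat) (x x0 y0 y : T) :
  x = x0 \/ before t (g x) (g x0) -> before t (g x0) (g y0) ->
  y0 = y \/ before t (g y0) (g y) -> before t (g x) (g y).
Proof.
move=> hx h hy; have {}hx : before t (g x) (g y0).
  by case: hx => [->|hx] //; apply: before_trans hx h.
by case: hy => [<-|hy] //; apply: before_trans hx hy.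
Qed.

Section ProductRule.
Variables (R : comNzRingType) (m : nat) (ty : pred nat) (vr : nat -> R).
Variables (D1 D2 : diagram) (p1 q1 p2 q2 : cell).
Hypotheses (k1 : corners D1 p1 q1) (k2 : corners D2 p2 q2).

Let x0 : D1 := [` corner_sw k1].
Let y0 : D2 := [` corner_ne k2].

Let pos (s : star) (z : D1 + D2) : cell :=
  match z with
  | inl x => ((val x).1 + (offset s p2 q1).1, (val x).2 + (offset s p2 q1).2)
  | inr y => val y
  end.

(** The condition on the two corner cells that become neighbours; the two cases are negations of
    each other. *)
Definition junction (s : star) (f : {ffun D1 + D2 -> 'I_m}) : bool :=
  match s with
  | Dot => before ty (f (inl x0)) (f (inr y0))
  | Odot => before (predC ty) (f (inr y0)) (f (inl x0))
  end.

Let row1 (x : D1) := corner_row k1 (valP x).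
Let col1 (x : D1) := corner_col k1 (valP x).
Let row2 (x : D2) := corner_row k2 (valP x).
Let col2 (x : D2) := corner_col k2 (valP x).

Lemma schur_star_op (s : star) :
  schur m ty vr (star_op s D1 D2) = cellsum m ty vr (pos s).
Proof.
symmetry; apply: cellsum_schur.
- have aux (x : D1) (y : D2) : pos s (inl x) <> pos s (inr y).
    move=> e; have := congr1 fst e; have := congr1 snd e; rewrite /= /offset /=.
    by have := row1 x; have := col1 x; have := row2 y; have := col2 y; case: s {e} => /=; lia.
  move=> [x|y] [x'|y'] e.
  - congr inl; apply/val_inj; case: e => /addIr e1 /addIr e2.
    by apply/eqP; rewrite -pair_eqE /pair_eq /= e1 e2 !eqxx.
  - by case: (aux _ _ e).
  - by case: (aux _ _ (esym e)).
  - by congr inr; apply/val_inj.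
- case=> [x|y]; rewrite (in_star_op s k1 k2) /=; last by rewrite (valP y) orbT.
  by rewrite !addrK -surjective_pairing (valP x).
- move=> c; rewrite (in_star_op s k1 k2) => /orP[cD|cD].
    by exists (inl [` cD]); rewrite /= !subrK -surjective_pairing.
  by exists (inr [` cD]).
Qed.

(** A line meeting both operands runs through both corner cells, so by transitivity of [before]
    every mixed condition follows from the one at the junction. *)
Lemma filling_star_op (s : star) (f : {ffun D1 + D2 -> 'I_m}) :
  filling (line (fstz (pos s)) (sndz (pos s))) (line (sndz (pos s)) (fstz (pos s))) ty f =
  [&& filling (line (fstz (val : D1 -> cell)) (sndz (val : D1 -> cell)))
              (line (sndz (val : D1 -> cell)) (fstz (val : D1 -> cell))) ty
              [ffun x => f (inl x)],
      filling (line (fstz (val : D2 -> cell)) (sndz (val : D2 -> cell)))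
              (line (sndz (val : D2 -> cell)) (fstz (val : D2 -> cell))) ty
              [ffun y => f (inr y)] & junction s f].
Proof.
have l1 x x' : (line (fstz (pos s)) (sndz (pos s)) (inl x) (inl x') =
     line (fstz (val : D1 -> cell)) (sndz (val : D1 -> cell)) x x') *
    (line (sndz (pos s)) (fstz (pos s)) (inl x) (inl x') =
     line (sndz (val : D1 -> cell)) (fstz (val : D1 -> cell)) x x').
  by rewrite /line /fstz /sndz /= !(inj_eq (@addIr _ _)) !ltrD2r.
apply/fillingP/and3P => [h|[/fillingP h1 /fillingP h2 hj]].
  split.
  - by apply/fillingP => x y; have := h (inl x) (inl y); rewrite !l1 !ffunE.
  - by apply/fillingP => x y; have := h (inr x) (inr y); rewrite !ffunE.
  rewrite /junction; case: s h {l1} => h.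
    by apply: (h (inl x0) (inr y0)).2; rewrite /line /fstz /sndz /= /offset /=; lia.
  by apply: (h (inr y0) (inl x0)).1; rewrite /line /fstz /sndz /= /offset /=; lia.
have {}h1 x y := h1 x y; have {}h2 x y := h2 x y.
move=> [x|y] [x'|y'].
- by have := h1 x x'; rewrite !l1 !ffunE.
- have := row1 x; have := col1 x; have := row2 y'; have := col2 y'.
  move: hj; rewrite /line /fstz /sndz /= /offset /junction.
  case: s {l1} => /= hj b1 b2 b3 b4; split; try by lia.
  move=> b5; apply: (@before_chain _ (fun z => f z : nat) ty (inl x) (inl x0) (inr y0) _ _ hj).
    case: (eqVneq x x0) => [->|ne]; [by left|right].
    have := (h1 x x0).2; rewrite !ffunE; apply; rewrite /line /fstz /sndz /=.
    have: (val x).1 != q1.1; last by move=> /=; lia.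
    apply: contraNneq ne => e; apply/eqP/val_inj/eqP; rewrite -pair_eqE /pair_eq /= e eqxx.
    by lia.
  case: (eqVneq y0 y') => [->|ne]; [by left|right].
  have := (h2 y0 y').2; rewrite !ffunE; apply; rewrite /line /fstz /sndz /=.
  have: (val y').1 != p2.1; last by move=> /=; lia.
  apply: contraNneq ne => e; apply/eqP/val_inj/eqP; rewrite -pair_eqE /pair_eq /= e eqxx.
  by lia.
- have := row1 x'; have := col1 x'; have := row2 y; have := col2 y.
  move: hj; rewrite /line /fstz /sndz /= /offset /junction.
  case: s {l1} => /= hj b1 b2 b3 b4; split; try by lia.
  move=> b5; apply: (@before_chain _ (fun z => f z : nat) (predC ty) (inr y) (inr y0) (inl x0) _ _ hj).
    case: (eqVneq y y0) => [->|ne]; [by left|right].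
    have := (h2 y y0).1; rewrite !ffunE; apply; rewrite /line /fstz /sndz /=.
    have: (val y).2 != p2.2; last by move=> /=; lia.
    apply: contraNneq ne => e; apply/eqP/val_inj/eqP; rewrite -pair_eqE /pair_eq /= e eqxx.
    by lia.
  case: (eqVneq x0 x') => [->|ne]; [by left|right].
  have := (h1 x0 x').1; rewrite !ffunE; apply; rewrite /line /fstz /sndz /=.
  have: (val x').2 != q1.2; last by move=> /=; lia.
  apply: contraNneq ne => e; apply/eqP/val_inj/eqP; rewrite -pair_eqE /pair_eq /= e eqxx.
  by lia.
- by have := h2 y y'; rewrite !ffunE.
Qed.

(** A pair of fillings satisfies exactly one of the two junction conditions, and so fills exactly
    one of the two glued diagrams. *)
Lemma schur_mul :
  schur m ty vr D1 * schur m ty vr D2 =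
  schur m ty vr (star_op Dot D1 D2) + schur m ty vr (star_op Odot D1 D2).
Proof.
rewrite !schur_star_op /schur /cellsum /fillsum big_distrlr /= pair_big /=.
pose F (f : {ffun D1 + D2 -> 'I_m}) : {ffun D1 -> 'I_m} * {ffun D2 -> 'I_m} :=
  ([ffun x => f (inl x)], [ffun y => f (inr y)]).
pose F' (g : {ffun D1 -> 'I_m} * {ffun D2 -> 'I_m}) : {ffun D1 + D2 -> 'I_m} :=
  [ffun z => match z with inl x => g.1 x | inr y => g.2 y end].
rewrite (reindex F); last first.
  exists F' => [f _|[g1 g2] _]; first by apply/ffunP => -[x|y]; rewrite !ffunE.
  by congr (_, _); apply/ffunP => x; rewrite !ffunE.
rewrite (bigID (junction Dot)) /=; congr (_ + _); apply: eq_big => f.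
- by rewrite filling_star_op -andbA.
- by move=> _; rewrite big_sumType /=; congr (_ * _); apply: eq_bigr => x _; rewrite ffunE.
- rewrite filling_star_op -andbA; congr [&& _, _ & _]; rewrite /junction /before /=.
  by rewrite negb_or -leqNgt; case: ltngtP => //= ->.
- by move=> _; rewrite big_sumType /=; congr (_ * _); apply: eq_bigr => x _; rewrite ffunE.
Qed.

End ProductRule.

(** * Strings of diagrams *)

Lemma same_shape_refl (D : diagram) : same_shape D D.
Proof.
by exists (0, 0); apply/fsetP => c; rewrite translateP /= !subr0 -surjective_pairing.
Qed.

Lemma same_shape_sym (D E : diagram) : same_shape D E -> same_shape E D.
Proof.
case=> v ->; exists (- v.1, - v.2); apply/fsetP => c.
by rewrite !translateP /= !opprK !addrK -surjective_pairing.
Qed.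

Lemma same_shape_trans (D E F : diagram) :
  same_shape D E -> same_shape E F -> same_shape D F.
Proof.
case=> v -> [w ->]; exists (v.1 + w.1, v.2 + w.2); apply/fsetP => c.
by rewrite !translateP /=; congr (in_mem (_, _) _); lia.
Qed.

Lemma same_shape_transpose (D E : diagram) :
  same_shape D E -> same_shape (transpose D) (transpose E).
Proof.
by case=> v ->; exists (v.2, v.1); apply/fsetP => c; rewrite !(transposeP, translateP).
Qed.

Lemma same_shape_rotate (D E : diagram) :
  same_shape D E -> same_shape (rotate D) (rotate E).
Proof.
case=> v ->; exists (- v.1, - v.2); apply/fsetP => c; rewrite !(rotateP, translateP) /=.
by congr (in_mem (_, _) _); lia.
Qed.

Lemma rotate_transpose (D : diagram) : rotate (transpose D) = transpose (rotate D).
Proof. by apply/fsetP => c; rewrite !(rotateP, transposeP). Qed.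

Definition solid (D : diagram) : Prop := convex D /\ D != fset0.

Lemma solid_corners (D : diagram) : solid D -> exists p q, corners D p q.
Proof. by case; apply: convex_corners. Qed.

Lemma corners_neq0 (D : diagram) (p q : cell) : corners D p q -> D != fset0.
Proof. by case=> pD _ _ _; apply/fset0Pn; exists p. Qed.

Lemma solid_shape (D E : diagram) : same_shape D E -> solid D -> solid E.
Proof.
case=> v -> sD; have [p [q k]] := solid_corners sD; split.
  by apply: convex_translate; case: sD.
exact: corners_neq0 (corners_translate v k).
Qed.

Lemma solid_transpose (D : diagram) : solid D -> solid (transpose D).
Proof.
move=> sD; have [p [q k]] := solid_corners sD; split.
  by apply: convex_transpose; case: sD.
exact: corners_neq0 (corners_transpose k).
Qed.

Lemma solid_iter_transpose (k : nat) (D : diagram) :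
  solid D -> solid (iter k transpose D).
Proof. by move=> sD; elim: k => //= k; apply: solid_transpose. Qed.

Lemma solid_rotate (D : diagram) : solid D -> solid (rotate D).
Proof.
move=> sD; have [p [q k]] := solid_corners sD; split.
  by apply: convex_rotate; case: sD.
exact: corners_neq0 (corners_rotate k).
Qed.

Lemma solid_star_op (s : star) (D1 D2 : diagram) :
  solid D1 -> solid D2 -> solid (star_op s D1 D2).
Proof.
move=> s1 s2; have [p1 [q1 k1]] := solid_corners s1; have [p2 [q2 k2]] := solid_corners s2.
split; last exact: corners_neq0 (corners_star_op s k1 k2).
by apply: convex_star_op k1 k2 _ _; [case: s1|case: s2].
Qed.

Lemma star_op_shape (s : star) (D1 D2 E1 E2 : diagram) : solid D1 -> solid D2 ->
  same_shape D1 E1 -> same_shape D2 E2 ->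
  same_shape (star_op s D1 D2) (star_op s E1 E2).
Proof.
move=> s1 s2; have [p1 [q1 k1]] := solid_corners s1; have [p2 [q2 k2]] := solid_corners s2.
case=> v1 -> [v2 ->]; exists v2; apply/fsetP => c.
rewrite (in_star_op s (corners_translate v1 k1) (corners_translate v2 k2)).
rewrite !translateP (in_star_op s k1 k2) /offset /=.
by congr (in_mem (_, _) _ || _); lia.
Qed.

Lemma star_opA (s s' : star) (D1 D2 D3 : diagram) :
  solid D1 -> solid D2 -> solid D3 ->
  star_op s D1 (star_op s' D2 D3) = star_op s' (star_op s D1 D2) D3.
Proof.
move=> s1 s2 s3; have [p1 [q1 k1]] := solid_corners s1.
have [p2 [q2 k2]] := solid_corners s2; have [p3 [q3 k3]] := solid_corners s3.
apply/fsetP => c; rewrite (in_star_op s k1 (corners_star_op s' k2 k3)).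
rewrite (in_star_op s' k2 k3) (in_star_op s' (corners_star_op s k1 k2) k3).
rewrite (in_star_op s k1 k2) orbA /offset /=.
by congr (in_mem (_, _) _ || _ || _); lia.
Qed.

Definition flip_star (s : star) : star := match s with Dot => Odot | Odot => Dot end.

(** Transposition swaps the north-east and south-west ends, hence the operands, and turns a vertical
    contact into a horizontal one. *)
Lemma transpose_star_op (s : star) (D1 D2 : diagram) : solid D1 -> solid D2 ->
  same_shape (star_op (flip_star s) (transpose D2) (transpose D1))
             (transpose (star_op s D1 D2)).
Proof.
move=> s1 s2; have [p1 [q1 k1]] := solid_corners s1; have [p2 [q2 k2]] := solid_corners s2.
exists ((offset s p2 q1).2, (offset s p2 q1).1); apply/fsetP => c.
rewrite transposeP (in_star_op s k1 k2) translateP.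
rewrite (in_star_op (flip_star s) (corners_transpose k2) (corners_transpose k1)).
rewrite !transposeP orbC /offset /= [c in c \in D2]surjective_pairing /=.
by congr (in_mem (_, _) _ || _); case: s => /=; lia.
Qed.

Lemma rotate_star_op (s : star) (D1 D2 : diagram) : solid D1 -> solid D2 ->
  same_shape (star_op s (rotate D2) (rotate D1)) (rotate (star_op s D1 D2)).
Proof.
move=> s1 s2; have [p1 [q1 k1]] := solid_corners s1; have [p2 [q2 k2]] := solid_corners s2.
exists (- (offset s p2 q1).1, - (offset s p2 q1).2); apply/fsetP => c.
rewrite rotateP (in_star_op s k1 k2) translateP.
rewrite (in_star_op s (corners_rotate k2) (corners_rotate k1)).
rewrite !rotateP orbC /offset /=.
by congr (_ || _); congr (in_mem (_, _) _); lia.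
Qed.

Definition str (w : seq star) (D : diagram) : diagram := star_string w D (transpose D).

Lemma str_cons (s : star) (w : seq star) (D : diagram) :
  str (s :: w) D = star_op s D (str w (transpose D)).
Proof. by rewrite /str /= transposeK. Qed.

Lemma solid_str (w : seq star) (D : diagram) : solid D -> solid (str w D).
Proof.
elim: w D => [|s w IH] D sD //; rewrite str_cons; apply: solid_star_op => //.
by apply/IH/solid_transpose.
Qed.

(** The word [u] uses up [size u + 1] copies, so the next one is [D] transposed that many times. *)
Lemma str_cat (u v : seq star) (s : star) (D : diagram) : solid D ->
  str (u ++ s :: v) D = star_op s (str u D) (str v (iter (size u).+1 transpose D)).
Proof.
elim: u D => [|s' u IH] D sD; first by rewrite /= str_cons.
have sT := solid_transpose sD.
rewrite cat_cons !str_cons IH // -iterSr star_opA //; first exact: solid_str.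
by apply/solid_str/solid_iter_transpose.
Qed.

Lemma str_shape (w : seq star) (D E : diagram) : solid D ->
  same_shape D E -> same_shape (str w D) (str w E).
Proof.
elim: w D E => [|s w IH] D E sD DE //; rewrite !str_cons.
apply: star_op_shape => //; first by apply/solid_str/solid_transpose.
by apply: IH; [apply: solid_transpose|apply: same_shape_transpose].
Qed.

Definition word_transpose (w : seq star) : seq star := rev (map flip_star w).

Lemma size_word_transpose (w : seq star) : size (word_transpose w) = size w.
Proof. by rewrite size_rev size_map. Qed.

Lemma iter_transpose (k : nat) (D : diagram) :
  iter k transpose D = if odd k then transpose D else D.
Proof. by elim: k => //= k ->; case: (odd k) => //=; rewrite transposeK. Qed.

(** The string now begins with its former last copy, [D] transposed [size w] times, which is itself
    transposed once more. *)
Lemma transpose_str (w : seq star) (D : diagram) : solid D ->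
  same_shape (str (word_transpose w) (iter (size w).+1 transpose D))
             (transpose (str w D)).
Proof.
elim: w D => [|s w IH] D sD; first exact: same_shape_refl.
have sT := solid_transpose sD; rewrite str_cons.
apply: same_shape_trans (transpose_star_op s sD (solid_str w sT)).
rewrite /word_transpose map_cons rev_cons -cats1 str_cat; last exact: solid_iter_transpose.
apply: star_op_shape.
- by apply/solid_str/solid_iter_transpose.
- by apply/solid_iter_transpose/solid_iter_transpose.
- by rewrite iterSr; apply: IH.
- rewrite -iterD size_word_transpose iter_transpose oddD /=.
  by case: (odd (size w)); apply: same_shape_refl.
Qed.

Lemma rotate_str (w : seq star) (D : diagram) : solid D ->
  same_shape (str (rev w) (iter (size w) transpose (rotate D))) (rotate (str w D)).
Proof.
elim: w D => [|s w IH] D sD; first exact: same_shape_refl.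
have sT := solid_transpose sD; have sR := solid_rotate sD; rewrite str_cons.
apply: same_shape_trans (rotate_star_op s sD (solid_str w sT)).
rewrite rev_cons -cats1 str_cat; last exact: solid_iter_transpose.
apply: star_op_shape.
- by apply/solid_str/solid_iter_transpose.
- by apply/solid_iter_transpose/solid_iter_transpose.
- by rewrite iterSr -rotate_transpose; apply: IH.
- rewrite -iterD size_rev iter_transpose oddD /=.
  by case: (odd (size w)); apply: same_shape_refl.
Qed.

(** The word of the composition of two ribbons: every second copy of [w] is transposed. *)
Fixpoint word_comp (u w : seq star) : seq star :=
  if u is s :: u' then w ++ s :: word_comp u' (word_transpose w) else w.

(** Associativity of the bullet operation on words. By [transpose_str], a transposed inner string is
    the string of the transposed word, beginning with just the copy of [D] or its transpose that
    continues the alternation. *)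
Lemma str_comp (u w : seq star) (D : diagram) : solid D ->
  same_shape (str u (str w D)) (str (word_comp u w) D).
Proof.
elim: u w D => [|s u IH] w D sD; first exact: same_shape_refl.
have sw := solid_str w sD; rewrite str_cons /= str_cat //.
apply: star_op_shape => //; first by apply/solid_str/solid_transpose.
  exact: same_shape_refl.
apply: same_shape_trans (IH _ _ (solid_iter_transpose _ sD)).
by apply: str_shape; [apply: solid_transpose|apply/same_shape_sym/transpose_str].
Qed.

(** * Generating functions of strings *)

Section Values.
Variable n : nat.

Definition value (w : seq star) (D : diagram) : {mpoly int[n]} := schurQ_poly n (str w D).

Lemma schurQ_poly_shape (D E : diagram) : same_shape D E ->
  schurQ_poly n D = schurQ_poly n E.
Proof. by case=> v ->; rewrite /schurQ_poly schur_translate. Qed.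

Lemma value_shape (w : seq star) (D E : diagram) : solid D -> same_shape D E ->
  value w D = value w E.
Proof. by move=> sD DE; apply/schurQ_poly_shape/str_shape. Qed.

Lemma value_mul (u v : seq star) (D : diagram) : solid D ->
  value u D * value v (iter (size u).+1 transpose D) =
  value (u ++ Dot :: v) D + value (u ++ Odot :: v) D.
Proof.
move=> sD; rewrite /value !str_cat //.
have [p1 [q1 k1]] := solid_corners (solid_str u sD).
have [p2 [q2 k2]] := solid_corners (solid_str v (solid_iter_transpose (size u).+1 sD)).
exact: schur_mul k1 k2.
Qed.

Lemma value_transpose (w : seq star) (D : diagram) : solid D ->
  value (word_transpose w) (iter (size w).+1 transpose D) = value w D.
Proof.
move=> sD; rewrite /value (schurQ_poly_shape (transpose_str w sD)).
by rewrite schurQ_poly_transpose //; case: (solid_str w sD).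
Qed.

Lemma value_rotate (w : seq star) (D : diagram) : solid D ->
  value (rev w) (iter (size w) transpose (rotate D)) = value w D.
Proof.
move=> sD; rewrite /value (schurQ_poly_shape (rotate_str w sD)).
by rewrite /schurQ_poly schur_rotate //; case: (solid_str w sD).
Qed.

Lemma mpoly_double_inj (x y : {mpoly int[n]}) : x + x = y + y -> x = y.
Proof. by move=> e; apply/mpolyP => k; have := congr1 (mcoeff k) e; rewrite !mcoeffD; lia. Qed.

Lemma alternating_telescope (R : comNzRingType) (Y : nat -> R) (k : nat) :
  \sum_(i < k) (-1) ^+ i * (Y i + Y i.+1) = Y 0%N - (-1) ^+ k * Y k.
Proof.
elim: k => [|k IH]; first by rewrite big_ord0 expr0 mul1r subrr.
by rewrite big_ord_recr /= IH exprS; ring.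
Qed.

(** There are [k] stars, hence [k + 1] copies; for a single cell this is a row of [k + 1] cells. *)
Definition row_value (k : nat) (D : diagram) := value (nseq k Odot) D.

Lemma col_value (k : nat) (D : diagram) : solid D ->
  value (nseq k Dot) D = row_value k (iter k.+1 transpose D).
Proof.
move=> sD; rewrite -value_transpose // /word_transpose map_nseq /=.
by rewrite size_nseq rev_nseq.
Qed.

(* With [h_k] the value of a row and [e_k] that of a column of [k] copies,
   alternately [D] and [D^t], the product rule gives [sum_i (-1)^i h_i e_(k-i) = 0],
   and transposition turns [e] into [h]. *)
Lemma row_value_transpose (k : nat) (D : diagram) : solid D ->
  row_value k (transpose D) = row_value k D.
Proof.
have [l kl] := ubnP k; elim: l k kl D => // l IHl k; rewrite ltnS => kl D sD.
have IH j E : (j < k)%N -> solid E -> row_value j (transpose E) = row_value j E.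
  by move=> jk; apply: IHl; apply: leq_trans jk kl.
have IHi j t E : (j < k)%N -> solid E -> row_value j (iter t transpose E) = row_value j E.
  by move=> jk sE; rewrite iter_transpose; case: ifP => // _; apply: IH.
pose c E := \sum_(i < k) (-1) ^+ i * (row_value i E * row_value (k - i.+1) E).
(* The sum [c] involves only shorter rows. With [Y i] the value of [i] stars [Odot] followed by
   [k - i] stars [Dot], its terms become [Y i + Y i.+1], so it telescopes to the two extreme
   strings. *)
have cE E : solid E ->
    c E = row_value k (iter k.+1 transpose E) - (-1) ^+ k * row_value k E.
  move=> sE; pose Y i := value (nseq i Odot ++ nseq (k - i) Dot) E.
  have -> : row_value k (iter k.+1 transpose E) = Y 0%N by rewrite -col_value // /Y subn0.
  have -> : row_value k E = Y k by rewrite /Y subnn cats0.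
  rewrite -alternating_telescope; apply: eq_bigr => -[i ik] _ /=; congr (_ * _).
  have -> : row_value (k - i.+1) E = value (nseq (k - i.+1) Dot) (iter i.+1 transpose E).
    by rewrite col_value; [rewrite -iterD IHi //; lia|apply: solid_iter_transpose].
  have := value_mul (nseq i Odot) (nseq (k - i.+1) Dot) sE; rewrite size_nseq => ->.
  rewrite /Y; congr (value _ _ + value _ _); first by rewrite -[in RHS](subnSK ik).
  by rewrite -cat1s catA; congr (_ ++ _); rewrite -[[:: Odot]]/(nseq 1 Odot) -nseqD addn1.
have cT : c (transpose D) = c D.
  by apply: eq_bigr => -[i ik] _; rewrite /= !IH //; lia.
have := cE D sD; have := cE _ (solid_transpose sD).
rewrite cT !iter_transpose /= transposeK => ->.
(* For [k] odd the extremes add up to twice one row value; for [k] even they give a difference that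
   changes sign when [D] is transposed. Either way twice the claim results. *)
rewrite -signr_odd; case: (odd k) => /=; rewrite ?expr0 ?expr1 => e.
  by apply: mpoly_double_inj; rewrite !mulN1r !opprK in e.
rewrite !mul1r in e; apply/esym/mpoly_double_inj.
by apply/eqP; rewrite -subr_eq0; apply/eqP; rewrite -(subrr (row_value k D - row_value k (transpose D))) {2}e; ring.
Qed.

(** The first [Dot] is removed by the product rule, leaving a product with the value of a shorter
    word and a word with one more leading [Odot]. The induction carries the number [j] of leading
    stars [Odot] along. *)
Lemma value_row_value (D E : diagram) : solid D -> solid E ->
  (forall k, row_value k D = row_value k E) -> forall w, value w D = value w E.
Proof.
move=> + + + w; rewrite -[w]cat0s -[[::]]/(nseq 0 Odot).
elim: w 0%N D E => [|s w IH] j D E sD sE DE; first by rewrite cats0; apply: DE.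
have cons_odot : nseq j Odot ++ Odot :: w = nseq j.+1 Odot ++ w.
  by rewrite -cat1s catA; congr (_ ++ _); rewrite -[[:: Odot]]/(nseq 1 Odot) -nseqD addn1.
case: s; last by rewrite cons_odot; apply: IH.
have dotE F : solid F -> value (nseq j Odot ++ Dot :: w) F =
    row_value j F * value w (iter j.+1 transpose F) - value (nseq j.+1 Odot ++ w) F.
  move=> sF; have := value_mul (nseq j Odot) w sF; rewrite size_nseq cons_odot => ->.
  by rewrite addrK.
rewrite !dotE // DE (IH j.+1 D E) //; congr (_ * _ - _).
(* The second factor may start with transposed copies; [row_value_transpose] transfers the
   hypothesis on rows to them. *)
apply: (IH 0%N); try exact: solid_iter_transpose.
by move=> k; rewrite !iter_transpose; case: ifP => // _; rewrite !row_value_transpose.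
Qed.

End Values.

(** * Variants *)

(** Quantifying over all words, rather than comparing [D] and [E] alone, makes the relation stable
    under forming strings. *)
Definition string_equiv (D E : diagram) : Prop :=
  forall (n : nat) (w : seq star), value n w D = value n w E.

Lemma string_equiv_trans (D E F : diagram) :
  string_equiv D E -> string_equiv E F -> string_equiv D F.
Proof. by move=> DE EF n w; rewrite DE EF. Qed.

Lemma string_equiv_shape (D E : diagram) : solid D -> same_shape D E -> string_equiv D E.
Proof. by move=> sD DE n w; apply: value_shape. Qed.

Lemma string_equiv_transpose (D : diagram) : solid D -> string_equiv D (transpose D).
Proof.
move=> sD n w; apply: value_row_value => //; first exact: solid_transpose.
by move=> k; rewrite row_value_transpose.
Qed.

Lemma string_equiv_iter_transpose (k : nat) (D : diagram) : solid D ->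
  string_equiv (iter k transpose D) D.
Proof.
move=> sD n w; rewrite iter_transpose; case: ifP => // _.
by rewrite -string_equiv_transpose.
Qed.

(** Only words with all stars [Odot] have to be compared, and these are unchanged by the reversal
    that rotation causes. *)
Lemma string_equiv_rotate (D : diagram) : solid D -> string_equiv D (rotate D).
Proof.
move=> sD n w; have sR := solid_rotate sD; apply: value_row_value => // k.
rewrite /row_value -value_rotate // size_nseq string_equiv_iter_transpose //.
by rewrite rev_nseq.
Qed.

Lemma string_equiv_variant (D E : diagram) : solid D -> is_variant D E ->
  solid E /\ string_equiv D E.
Proof.
move=> sD; have sT := solid_transpose sD; have sR := solid_rotate sD.
have sRT := solid_rotate sT; case=> DE; split; try exact: solid_shape DE _.
- exact: string_equiv_shape.
- exact: string_equiv_trans (string_equiv_transpose sD) (string_equiv_shape sT DE).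
- exact: string_equiv_trans (string_equiv_rotate sD) (string_equiv_shape sR DE).
- apply: string_equiv_trans (string_equiv_transpose sD) _.
  exact: string_equiv_trans (string_equiv_rotate sT) (string_equiv_shape sRT DE).
Qed.

(** By [str_comp] every string of [str u D] is again a string of [D]. *)
Lemma string_equiv_str (u : seq star) (D E : diagram) : solid D -> solid E ->
  string_equiv D E -> string_equiv (str u D) (str u E).
Proof.
move=> sD sE DE n w; have := DE n (word_comp w u); rewrite /value.
by rewrite -(schurQ_poly_shape n (str_comp w u sD)) -(schurQ_poly_shape n (str_comp w u sE)).
Qed.

(** Transposing the whole string is harmless and yields the transposed word on [D] or its transpose;
    exchanging these is harmless too. *)
Lemma string_equiv_word_transpose (w : seq star) (D : diagram) : solid D ->
  string_equiv (str w D) (str (word_transpose w) D).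
Proof.
move=> sD; have sw := solid_str w sD.
apply: string_equiv_trans (string_equiv_transpose sw) _.
apply: string_equiv_trans (string_equiv_shape (solid_transpose sw)
  (same_shape_sym (transpose_str w sD))) _.
apply: string_equiv_str => //; first exact: solid_iter_transpose.
exact: string_equiv_iter_transpose.
Qed.

Lemma string_equiv_rev (w : seq star) (D : diagram) : solid D ->
  string_equiv (str w D) (str (rev w) D).
Proof.
move=> sD; have sw := solid_str w sD; have sR := solid_rotate sD.
apply: string_equiv_trans (string_equiv_rotate sw) _.
apply: string_equiv_trans (string_equiv_shape (solid_rotate sw)
  (same_shape_sym (rotate_str w sD))) _.
apply: string_equiv_str => //; first exact: solid_iter_transpose.
apply: string_equiv_trans (string_equiv_iter_transpose _ sR) _.
by move=> n u; rewrite -string_equiv_rotate.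
Qed.

(** * Variants of the ribbon factors *)

Lemma transpose_square : transpose square = square.
Proof. by apply/fsetP => -[a b]; rewrite transposeP !in_fset1 -!pair_eqE /pair_eq /= andbC. Qed.

Lemma rotate_square : rotate square = square.
Proof. by apply/fsetP => -[a b]; rewrite rotateP !in_fset1 -!pair_eqE /pair_eq /= !oppr_eq0. Qed.

Lemma solid_square : solid square.
Proof.
split; last by apply/fset0Pn; exists (0, 0); rewrite in_fset1.
by move=> i j i' j' a b; rewrite !in_fset1 -!pair_eqE /pair_eq /=; lia.
Qed.

Lemma str_square_transpose (w : seq star) :
  same_shape (str (word_transpose w) square) (transpose (str w square)).
Proof.
have := transpose_str w solid_square.
by rewrite iter_transpose transpose_square if_same.
Qed.

Lemma str_square_rotate (w : seq star) :
  same_shape (str (rev w) square) (rotate (str w square)).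
Proof.
have := rotate_str w solid_square.
by rewrite rotate_square iter_transpose transpose_square if_same.
Qed.

(** A ribbon is the string of its word on the square, which is fixed by transposition and rotation,
    so these act on the word alone. *)
Lemma ribbon_word_variant (A B : diagram) : is_ribbon A -> is_variant A B ->
  let w := ribbon_word A in
  [\/ ribbon_word B = w, ribbon_word B = word_transpose w, ribbon_word B = rev w
    | ribbon_word B = rev (word_transpose w)].
Proof.
move=> rA vAB w; have strE v : star_string v square square = str v square.
  by rewrite /str transpose_square.
have uniq v : same_shape (str v square) B -> ribbon_word B = v.
  by rewrite -strE; apply: ribbon_word_uniq.
have wA : same_shape (str w square) A by rewrite -strE; apply: ribbon_wordP.
have wT := same_shape_trans (str_square_transpose w) (same_shape_transpose wA).
have wR := same_shape_trans (str_square_rotate w) (same_shape_rotate wA).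
have wRT := same_shape_trans (str_square_rotate (word_transpose w)) (same_shape_rotate wT).
case: vAB => AB; [apply: Or41|apply: Or42|apply: Or43|apply: Or44]; apply: uniq.
- exact: same_shape_trans wA AB.
- exact: same_shape_trans wT AB.
- exact: same_shape_trans wR AB.
- exact: same_shape_trans wRT AB.
Qed.

Lemma string_equiv_bullet (A B D E : diagram) : is_ribbon A -> is_variant A B ->
  solid D -> solid E -> string_equiv D E ->
  string_equiv (bullet A D) (bullet B E).
Proof.
move=> rA vAB sD sE DE; rewrite /bullet -!/(str _ _).
(* The word of [A] is replaced with [D] kept fixed, and [D] by [E] under the new word. *)
apply: string_equiv_trans (string_equiv_str (ribbon_word B) sD sE DE).
case: (ribbon_word_variant rA vAB) => ->.
- by [].
- exact: string_equiv_word_transpose.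
- exact: string_equiv_rev.
- apply: string_equiv_trans (string_equiv_word_transpose _ sD) _.
  exact: string_equiv_rev.
Qed.

Lemma string_equiv_bullets (As Bs : seq diagram) (D E : diagram) :
  size As = size Bs ->
  (forall i, (i < size As)%N -> is_ribbon (nth fset0 As i)) ->
  (forall i, (i < size As)%N -> is_variant (nth fset0 As i) (nth fset0 Bs i)) ->
  solid D -> solid E -> string_equiv D E ->
  [/\ solid (bullets As D), solid (bullets Bs E)
    & string_equiv (bullets As D) (bullets Bs E)].
Proof.
move=> + + + sD sE DE; elim: As Bs => [|A As IH] [|B Bs] //= [sz] hr hv.
have [sF sG FG] := IH Bs sz (fun i => hr i.+1) (fun i => hv i.+1).
split; try exact: solid_str.
by apply: string_equiv_bullet => //; [apply: (hr 0%N)|apply: (hv 0%N)].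
Qed.

(** The empty diagram has no corners and is treated apart: all its strings are empty. *)
Lemma star_op0 (s : star) : star_op s fset0 fset0 = fset0.
Proof. by apply/fsetP => c; case: s; rewrite in_fsetU !translateP !in_fset0. Qed.

Lemma transpose0 : transpose fset0 = fset0.
Proof. by apply/fsetP => c; rewrite transposeP !in_fset0. Qed.

Lemma rotate0 : rotate fset0 = fset0.
Proof. by apply/fsetP => c; rewrite rotateP !in_fset0. Qed.

Lemma bullets0 (As : seq diagram) : bullets As fset0 = fset0.
Proof.
elim: As => //= A As ->; rewrite /bullet transpose0.
by elim: (ribbon_word A) => //= s w ->; apply: star_op0.
Qed.

Lemma is_variant0 (E : diagram) : is_variant fset0 E -> E = fset0.
Proof.
rewrite /is_variant transpose0 rotate0.
by case=> -[v ->]; apply/fsetP => c; rewrite translateP !in_fset0.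
Qed.

Lemma ord_schurQ_equiv (D E : diagram) : string_equiv D E -> ord_schurQ D =1 ord_schurQ E.
Proof.
move=> DE s; apply/eqP; rewrite -(eqr_nat int) /ord_schurQ !tableau_seriesE.
(* The coefficient at [s] is read off in [size s] variables, and the empty word gives the diagram
   itself. *)
by have := DE (size s) [::]; rewrite /value /str /= => ->.
Qed.

Theorem theorem4p10 (m : nat) (alpha beta : m.-tuple diagram) (D E : diagram) :
  (forall i : 'I_m, is_ribbon (tnth alpha i)) ->
  is_skew_diagram D ->
  (forall i : 'I_m, is_variant (tnth alpha i) (tnth beta i)) ->
  is_variant D E ->
  ord_schurQ (bullets alpha D) =1 ord_schurQ (bullets beta E).
Proof.
move=> hr skD hv vDE; have [D0|Dn0] := eqVneq D fset0.
  (* If [D] is empty it is not [solid], but then both sides are the series of the empty diagram. *)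
  by move: vDE; rewrite D0 => /is_variant0 ->; rewrite !bullets0.
have sD : solid D by split=> // i j i' j' a b; apply: skew_convex.
have [sE DE] := string_equiv_variant sD vDE; apply: ord_schurQ_equiv.
have [] // := string_equiv_bullets (As := alpha) (Bs := beta) _ _ _ sD sE DE.
- by rewrite !size_tuple.
- move=> i; rewrite size_tuple => im.
  by have := hr (Ordinal im); rewrite (tnth_nth fset0).
- move=> i; rewrite size_tuple => im.
  by have := hv (Ordinal im); rewrite !(tnth_nth fset0).
Qed.
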